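(* Let $G$ be an amenable locally compact group that is $\sigma$-compact and non-unimodular. Then $\mathrm{TLIM}_0(G)\neq\mathrm{TLIM}(G)$.
   Context: $|E|$ denotes the left Haar measure of $E\subset G$. $\mathcal L_\infty(G)$ is the usual space with respect to Haar measure, identified with the dual of $\mathcal L_1(G)$. The set of means is $\mathcal M(G)=\{\mu\in\mathcal L_\infty^*(G): \|\mu\|=1,\ \mu\ge 0\}$. Write $l_x\phi(y)=\phi(x^{-1}y)$. $G$ is amenable if there is $\mu\in\mathcal M(G)$ with $\mu(\phi)=\mu(l_x\phi)$ for all $x\in G$ and $\phi\in\mathcal L_\infty(G)$. Each $f\in\mathcal L_1(G)$ is regarded as an element of $\mathcal L_\infty^*(G)$ via $\phi\mapsto\int_G f\phi$; $\mathcal M_1(G)=\{f\in\mathcal L_1(G):\|f\|_1=1,\ f\ge0\}$. For $f\in\mathcal M_1(G)$, $\phi\in\mathcal L_\infty(G)$, $f*\phi=\int_G f(x)\,l_x\phi\,dx$. The topological left-invariant means are $\mathrm{TLIM}(G)=\{\mu\in\mathcal M(G): \mu(\phi)=\mu(f*\phi)\ \text{for all } f\in\mathcal M_1(G),\ \phi\in\mathcal L_\infty(G)\}$. For a compact set $A\subset G$ of positive measure, $\mu_A=\chi_A/|A|$. For $K\subset G$ and $\epsilon>0$, $\mathscr C^+(K,\epsilon)$ is the set of compact $A\subset G$ with $|A|>0$ and $|xA\triangle A|/|A|<\epsilon$ for all $x\in K$. For a mean $\mu$ write $\mu(E)=\mu(\chi_E)$. For a finite measurable partition $\mathcal P$ of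 $G$ and $\epsilon\in(0,1)$, $\mathcal N(\mu,\mathcal P,\epsilon)=\{\nu\in\mathcal M(G): |\mu(E)-\nu(E)|<\epsilon\ \text{for all } E\in\mathcal P\}$. Then $\mathrm{TLIM}_0(G)$ is the set of $\mu\in\mathrm{TLIM}(G)$ such that for every finite measurable partition $\mathcal P$ of $G$, every compact $K\subset G$ and every $\epsilon\in(0,1)$ there is $A\in\mathscr C^+(K,\epsilon)$ with $\mu_A\in\mathcal N(\mu,\mathcal P,\epsilon)$. *)

(* Defs.v *)
From HB Require Import structures.
From mathcomp Require Import all_boot all_order all_algebra.
From mathcomp Require Import all_classical all_reals all_analysis.
From mathcomp Require Import measurable_realfun ess_sup_inf.

Set Implicit Arguments.
Unset Strict Implicit.
Unset Printing Implicit Defensive.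

Import Order.TTheory GRing.Theory Num.Theory.
Import numFieldNormedType.Exports.

Local Open Scope classical_set_scope.
Local Open Scope ring_scope.

HB.mixin Record isTopologicalGroup G & Group G & Topological G := {
  mulg_continuous : continuous (fun z : G * G => (z.1 * z.2)%g) ;
  invg_continuous : continuous (fun x : G => (x^-1)%g)
}.

(* The distinguished point is arbitrary and plays no role: it is only there
   because measurable types are pointed. *)
#[short(type="topGroupType")]
HB.structure Definition TopGroup :=
  {G of Group G & PointedTopological G & isTopologicalGroup G}.

Definition sigma_compact (T : topologicalType) (A : set T) : Prop :=
  exists F : (set T)^nat, (forall n, compact (F n)) /\ A = \bigcup_n F n.

Notation borel G := (g_sigma_algebraType (@open G)).

Section TopGroup_defs.
Context {G : topGroupType}.

Definition ltrans (x : G) (A : set G) : set G := [set (x * y)%g | y in A].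
Definition rtrans (A : set G) (x : G) : set G := [set (y * x)%g | y in A].

End TopGroup_defs.

Lemma Lfun1y_integrable d (T : measurableType d) (R : realType)
    (mu : {measure set T -> \bar R}) (f : LfunType mu (@lexx _ _ 1%E))
    (g : LfunType mu (leey 1%E)) :
  mu.-integrable setT (EFin \o (fun x => f x * g x)).
Proof.
have [C gC] : exists C : R, \forall x \ae mu, `|g x| <= C.
  have := Lfunction_finite _ g; rewrite /finite_norm unlock.
  case: ifPn => [mu0|]; last first.
    rewrite -leNgt => mu0 _; exists 0; exists setT; split => //.
    by apply/eqP; rewrite eq_le mu0 measure_ge0.
  have Nnoo : (-oo < ess_sup mu (abse \o (EFin \o g)))%E.
    apply: (@lt_le_trans _ _ 0%E) => //.
    by apply: ess_sup_ger => // x; rewrite abse_ge0.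
  move=> Noo; exists (fine (ess_sup mu (abse \o (EFin \o g)))).
  have := ess_sup_ge mu (abse \o (EFin \o g)).
  apply: filterS => x /= gx.
  by rewrite -lee_fin fineK// fin_numElt Nnoo.
have /Lfun1_integrable /integrableP[mf intf] := LfunP f.
have mfg : measurable_fun setT (fun x => (f x * g x)%:E).
  by apply/measurable_EFinP; exact: measurable_funM.
apply/integrableP; split => //.
apply: (@le_lt_trans _ _ (\int[mu]_x (`|C|%:E * `|(f x)%:E|))%E); last first.
  rewrite ge0_integralZl//; first by rewrite lte_mul_pinfty.
  exact: measurableT_comp.
apply: ae_ge0_le_integral => //.
- exact: measurableT_comp.
- by apply: measurable_funeM; exact: measurableT_comp.
- move: gC; apply: filterS => x gx _ /=.
  rewrite lee_fin normrM mulrC ler_wpM2r//.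
  by rewrite (le_trans gx)// ler_norm.
Qed.

Section Haar.
Context {R : realType} {G : topGroupType}.
Variable haar : {measure set (borel G) -> \bar R}.

Record left_haar : Prop := LeftHaar {
  haar_neq0 : haar [set: G] != 0%E ;
  haar_compact : forall K : set G, compact K -> (haar K < +oo)%E ;
  haar_outer_regular : forall E : set (borel G), measurable E ->
    haar E = ereal_inf [set haar U | U in [set U : set G | open U /\ E `<=` U]] ;
  haar_inner_regular : forall U : set G, open U ->
    haar U =
    ereal_sup [set haar K | K in [set K : set G | compact K /\ K `<=` U]] ;
  haar_ltrans : forall (x : G) (E : set (borel G)), measurable E ->
    haar (ltrans x E) = haar E
}.

Definition unimodular : Prop :=
  forall (x : G) (E : set (borel G)), measurable E ->
    haar (rtrans E x) = haar E.

(* These are spaces of functions, not of classes modulo a.e. equality.  A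
   linear functional on Linfty of finite norm vanishes on the functions of zero
   essential supremum, so it is the same as an element of the dual of the
   quotient. *)
Definition L1 := LfunType haar (@lexx _ _ 1%E).
Definition Linfty := LfunType haar (leey 1%E).

Definition dual_norm (m : {scalar Linfty}) : \bar R :=
  ereal_sup [set `|m phi|%:E
            | phi in [set phi : Linfty | ('N[haar]_+oo[EFin \o phi] <= 1)%E]].

Definition means : set {scalar Linfty} :=
  [set m | dual_norm m = 1%E /\
    forall phi : Linfty, (\forall x \ae haar, 0 <= phi x) -> 0 <= m phi].

(* The functions chi E, ltransl x phi, convol f phi and mean_of A below are
   turned into elements of Linfty or L1 by insubd.  When haar is a left Haar
   measure on a locally compact Hausdorff group, its default value 0 is never
   reached: E is taken Borel, A is taken compact of positive measure, ltransl is
   precomposition with a homeomorphism preserving null sets, and f * phi is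
   bounded and continuous because left translation is continuous in L1. *)
Definition chi (E : set (borel G)) : Linfty :=
  insubd (0 : Linfty) (\1_E : borel G -> R).

Definition ltransl (x : G) (phi : Linfty) : Linfty :=
  insubd (0 : Linfty) (fun y : borel G => phi (x^-1 * y)%g).

Definition convol (f : L1) (phi : Linfty) : Linfty :=
  insubd (0 : Linfty)
    (fun y : borel G => \int[haar]_x (f x * phi ((x : G)^-1 * y)%g)).

Definition pairing (f : L1) (phi : Linfty) : R := \int[haar]_x (f x * phi x).

Lemma pairing_scalar (f : L1) : scalar (pairing f).
Proof.
move=> a phi psi; rewrite /pairing.
rewrite -RintegralZl//; last exact: Lfun1y_integrable.
rewrite -RintegralD//.
- by apply: eq_Rintegral => x _ /=; rewrite mulrDr mulrCA.
- have := Lfun1y_integrable f (a *: phi); congr (integrable _ _ _).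
  by apply/funext => x /=; rewrite mulrCA.
- exact: Lfun1y_integrable.
Qed.

HB.instance Definition _ (f : L1) :=
  GRing.isLinear.Build R Linfty R *%R (pairing f) (pairing_scalar f).

Definition dual_of_L1 (f : L1) : {scalar Linfty} := pairing f.

Definition means1 : set L1 :=
  [set f | 'N[haar]_1[EFin \o f]%E = 1%E /\ \forall x \ae haar, 0 <= f x].

Definition amenable : Prop :=
  exists2 m, means m &
    forall (x : G) (phi : Linfty), m phi = m (ltransl x phi).

Definition TLIM : set {scalar Linfty} :=
  [set m | means m /\
    forall (f : L1) (phi : Linfty), means1 f -> m phi = m (convol f phi)].

Definition mean_of (A : set (borel G)) : L1 :=
  insubd (0 : L1) (fun x : borel G => \1_A x / fine (haar A)).

Definition Cplus (K : set G) (eps : R) : set (set G) :=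
  [set A | [/\ compact A, (0 < haar A)%E &
    forall x, K x -> fine (haar (ltrans x A `+` A)) / fine (haar A) < eps]].

Definition finite_measurable_partition (P : set (set (borel G))) : Prop :=
  [/\ finite_set P, P `<=` measurable & partition P id [set: G]].

Definition mean_nbhs (m : {scalar Linfty}) (P : set (set (borel G))) (eps : R) :
    set {scalar Linfty} :=
  [set n | means n /\ forall E, P E -> `|m (chi E) - n (chi E)| < eps].

Definition TLIM0 : set {scalar Linfty} :=
  [set m | TLIM m /\
    forall (P : set (set (borel G))) (K : set G) (eps : R),
      finite_measurable_partition P -> compact K -> 0 < eps < 1 ->
      exists2 A, Cplus K eps A & mean_nbhs m P eps (dual_of_L1 (mean_of A))].

End Haar.

Arguments means {R G} haar.
Arguments means1 {R G} haar.
Arguments TLIM {R G} haar.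
Arguments TLIM0 {R G} haar.

(* Main.v *)
From HB Require Import structures.
Require Import Defs.
From mathcomp Require Import all_boot all_order all_algebra.
From mathcomp Require Import all_classical all_reals all_analysis.
From mathcomp Require Import measurable_realfun ess_sup_inf.

(** Write |E| for the left Haar measure and D for the modular function,
    |E z| = D z |E|. As G is not unimodular, D takes arbitrarily small values;
    this allows invariant means to live on sets that a compact almost invariant
    set can fill only badly.

    Let K_n be compact sets increasing to G. Choose x_n one after the other so
    that D on Q_n = K_n x_n takes values in [d_(n+1), d_n), where d_n decreases
    at least as fast as 2^-n, and |Q_n| <= d_n / 2 ([sparse_sequence]). The
    unions E_0 and E_1 of the Q_n with n even and with n odd are disjoint, and
    each contains right translates of larger and larger compact sets. Such a set
    carries a topologically invariant mean: [thick_TLIM] provides mu_0 and mu_1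
    in TLIM with mu_i (E_i) = 1, and mu = (mu_0 + mu_1) / 2 is in TLIM too.

    Suppose that mu is in TLIM_0, and let K be compact with |K| > 65. There is a
    compact A that moves by less than |A| / 8 under K and of which each E_i
    contains more than 3/8. Put t = |A| / 8, let n be least with d_(n+1) <= t
    and let i be the parity other than the one of n. Then the points of E_i where
    D < t lie in the Q_k with k > n, whose union has measure at most
    d_(n+1) <= t. Now measure the set of the pairs (x, s) in K x A with x s in
    A in two ways. By almost invariance of A it is at least 7/8 |K| |A|. On the
    other hand, the x that go with a given s are in K and in A s^-1; their
    measure is at most |A| / D s <= 8 where D s >= t, and at most |K| elsewhere.
    Hence 7/8 |K| |A| <= 8 |A| + (1/8 + 5/8) |K| |A|, so that |K| <= 64
    ([folner_bound]), a contradiction.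

    The mean on a thick set is built from a left invariant mean m and a
    nonprincipal ultrafilter: for phi in L^oo and f in L^1, average over m the
    function y |-> lim_n (f * phi) (y x_n) ([shift_mean]). For fixed phi this is
    a bounded left invariant functional of f, hence a multiple of the integral
    of f ([invariant_functional], which is uniqueness of Haar measure), so that
    it has the same value for all f >= 0 of integral 1. As f * phi is left
    uniformly continuous, convolving it once more with a density concentrated
    near 1 hardly changes it, and topological invariance follows
    ([shift_mean_absorb]).

    Both the uniqueness of Haar measure and the counting argument exchange
    integrals over compact subsets of G x G. These need not be measurable for
    the product of the Borel sigma-algebras, so the exchange is proved directly
    for compact sets and finite tight measures ([compact_fubini]). *)

Set Implicit Arguments.
Unset Strict Implicit.
Unset Printing Implicit Defensive.

Import Order.TTheory GRing.Theory Num.Theory.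
Import numFieldNormedType.Exports.

Local Open Scope classical_set_scope.
Local Open Scope ring_scope.

(** * Fubini's theorem for compact subsets of a product *)

Section Topology.
Context {X : topologicalType}.

(** The sets [A] such that [P (K `\` A)] form a filter. If [P K] failed it
    would be proper, and would cluster at a point of [K] none of whose
    neighbourhoods satisfies [P]. *)
Lemma compact_ind (P : set X -> Prop) (K : set X) : P set0 ->
  (forall A B, A `<=` B -> P B -> P A) ->
  (forall A B, P A -> P B -> P (A `|` B)) ->
  compact K -> (forall x, K x -> exists2 W, nbhs x W & P W) -> P K.
Proof.
move=> P0 Psub PU cK locP; apply: contrapT => nPK.
have FF : ProperFilter [set A | P (K `\` A)].
  split; first by rewrite /= setD0.
  split; first by rewrite /= setDT.
    by move=> A B /= PA PB; rewrite setDIr; exact: PU.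
  by move=> A B AB; apply: Psub; exact: setDS.
have /= [|x [Kx clx]] := cK _ FF; first by rewrite /= setDv.
have [W xW PW] := locP _ Kx.
have [|y [/=]] := clx (~` W) W _ xW; last by [].
by rewrite /= setDE setCK; apply: Psub PW; exact: subIsetr.
Qed.

End Topology.

Section Borel.
Context {X : ptopologicalType}.
Implicit Types A : set X.

Lemma borel_open A : open A -> measurable (A : set (borel X)).
Proof. exact: sub_sigma_algebra. Qed.

Lemma borel_closed A : closed A -> measurable (A : set (borel X)).
Proof.
move=> cA; rewrite -[A]setCK.
apply: (@measurableC _ (borel X)); apply: borel_open; exact: closed_openC.
Qed.

Lemma borel_compact A : hausdorff_space X -> compact A ->
  measurable (A : set (borel X)).
Proof. move=> hX cA; exact: (borel_closed (compact_closed hX cA)). Qed.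

End Borel.

Section Tight.
Context {X : ptopologicalType} {R : realType}.
Hypothesis hX : hausdorff_space X.
Implicit Types mu : {measure set (borel X) -> \bar R}.

(** Inner regularity on all Borel sets, with the error stated on the difference
    so that it makes sense for sets of infinite measure too. *)
Definition tight mu := forall (E : set (borel X)) (e : R), measurable E ->
  0 < e -> exists C : set X, [/\ compact C, C `<=` E & (mu (E `\` C) < e%:E)%E].

(** A compact set that almost fills the complement of [C] has an open
    complement that hardly exceeds [C]. *)
Lemma tight_outer mu (C : set X) (e : R) : (mu setT < +oo)%E ->
  tight mu -> compact C -> 0 < e ->
  exists U : set X, [/\ open U, C `<=` U & (mu U < mu C + e%:E)%E].
Proof.
move=> mufin tmu cC e0; have mC := borel_compact hX cC.
have [D [cD DC muD]] := tmu _ _ (measurableC mC) e0.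
have mD := borel_compact hX cD.
exists (~` D); split.
- exact: closed_openC (compact_closed hX cD).
- by rewrite -[C]setCK; exact: subsetC.
have mCD : measurable ((~` C `\` D) : set (borel X)).
  by apply: measurableD => //; exact: measurableC.
have -> : ~` D = (C `|` (~` C `\` D)) :> set X.
  apply/seteqP; split => [x Dx|x [Cx /DC//|[]//]].
  by have [Cx|Cx] := pselect (C x); [left|right].
rewrite measureU//; last first.
  by rewrite setDE setIA setICr set0I.
rewrite lteD2lE// ge0_fin_numE//.
by apply: le_lt_trans mufin; apply: le_measure; rewrite ?inE.
Qed.

End Tight.

Section TightExhaustion.
Context {X : ptopologicalType} {R : realType}.
Hypothesis hX : hausdorff_space X.
Implicit Types mu nu : {measure set (borel X) -> \bar R}.

Lemma tight_exhaustion mu (E : set (borel X)) : tight mu -> measurable E ->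
  exists C : (set X)^nat, [/\ forall n, compact (C n), nondecreasing_seq C,
    forall n, C n `<=` E & mu (E `\` \bigcup_n C n) = 0%E].
Proof.
move=> tmu mE.
have h n : exists C : set X, [/\ compact C, C `<=` E &
  (mu (E `\` C) < n.+1%:R^-1%:E)%E].
  exact: tmu.
have [D HD] := choice h.
pose C n := \big[setU/set0]_(i < n.+1) D i.
have cC n : compact (C n).
  by apply: bigsetU_compact => i _; have [] := HD i.
have DC n : D n `<=` C n by rewrite /C big_ord_recr/=; exact: subsetUr.
have CE n : C n `<=` E.
  by rewrite /C => x; rewrite -bigcup_mkord => -[i _]; have [_ DE _] := HD i; exact: DE.
exists C; split => //.
  move=> m n mn; apply/subsetPset; rewrite /C.
  by apply: subset_bigsetU.
have mC n : measurable (C n : set (borel X)) by exact: borel_compact.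
have mU : measurable (\bigcup_n C n : set (borel X)) by exact: bigcup_measurable.
apply/eqP; rewrite eq_le measure_ge0 andbT; apply/lee_addgt0Pr => e e0.
rewrite add0e.
have [n ne] : exists n, n.+1%:R^-1 < e.
  exists (Num.truncn e^-1); rewrite invf_plt ?posrE//; exact: truncnS_gt.
have [_ _ /ltW Dn] := HD n.
apply: (@le_trans _ _ (mu (E `\` D n))).
  apply: le_measure; rewrite ?inE.
  - exact: measurableD.
  - by apply: measurableD => //; apply: (borel_compact hX); have [] := HD n.
  - by apply: setDS; apply: subset_trans (DC n) _; exact: bigcup_sup.
by apply: le_trans Dn _; rewrite lee_fin ltW.
Qed.

(** Compact sets that fill [E] up to a [mu]-null set also fill it up to a
    [nu]-null set, and finiteness of [nu] makes what remains small. *)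
Lemma tight_dominates mu nu : tight mu -> (nu setT < +oo)%E ->
  (forall E, measurable E -> mu E = 0 -> nu E = 0)%E -> tight nu.
Proof.
move=> tmu nufin numu E e mE e0.
have [C [cC ndC CE muC]] := tight_exhaustion tmu mE.
have mC n : measurable (C n : set (borel X)) by exact: borel_compact.
have mEC n : measurable (E `\` C n : set (borel X)) by exact: measurableD.
have mI : measurable (\bigcap_n (E `\` C n) : set (borel X)) by
  exact: bigcap_measurable.
have IE : \bigcap_n (E `\` C n) = E `\` \bigcup_n C n.
  by rewrite setDE setC_bigcup -bigcapIr.
have nu0 : (nu (\bigcap_n (E `\` C n)) = 0)%E by rewrite IE numu// -IE.
have : nu \o (fun n => E `\` C n) @ \oo --> 0%E.
  rewrite -nu0; apply: nonincreasing_cvg_mu => //.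
    by apply: le_lt_trans nufin; apply: le_measure; rewrite ?inE.
  move=> m n mn; apply/subsetPset; apply: setDS; apply/subsetPset; exact: ndC.
move=> /fine_cvgP [nufn].
move=> /cvgrPdist_lt /(_ _ e0) near_e.
have [n _ Hn] := filterI nufn near_e.
have [/= nf ne] := Hn n (leqnn n).
exists (C n); split => //.
move: ne => /=; rewrite sub0r normrN -lte_fin => ne.
rewrite -(fineK nf); apply: le_lt_trans ne.
by rewrite lee_fin ler_norm.
Qed.

End TightExhaustion.

Section CompactSections.
Context {X Y : ptopologicalType} {R : realType}.
Hypotheses (hX : hausdorff_space X) (hY : hausdorff_space Y).
Implicit Types C : set (X * Y).

Lemma compact_xsect C x : compact C -> compact [set y | C (x, y)].
Proof.
move=> cC.
have -> : [set y | C (x, y)] = snd @` (C `&` fst @^-1` [set x]).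
  apply/seteqP; split => [y Cxy|_ [[x' y] /= [Cxy xx']] <-]; last by rewrite /= -xx'.
  by exists (x, y).
apply: continuous_compact.
  by apply: continuous_subspaceT => z; exact: cvg_snd.
apply: compact_closedI => //; apply: closed_comp.
  by move=> z _; exact: cvg_fst.
exact: (compact_closed hX (@compact_set1 _ x)).
Qed.

(** The sections of a compact set are upper semicontinuous: the part of [C]
    outside of [X * U] has a compact, hence closed, projection to [X]. *)
Lemma xsect_tube C x (U : set Y) : compact C -> open U ->
  [set y | C (x, y)] `<=` U ->
  exists2 W : set X, open W /\ W x & forall x', W x' -> [set y | C (x', y)] `<=` U.
Proof.
move=> cC oU CU; exists (~` (fst @` (C `&` snd @^-1` (~` U)))).
  split.
    apply: closed_openC; apply: (compact_closed hX).
    apply: continuous_compact.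
      by apply: continuous_subspaceT => z; exact: cvg_fst.
    apply: compact_closedI => //; apply: closed_comp.
      by move=> z _; exact: cvg_snd.
    exact: open_closedC.
  by move=> [[x' y] /= [Cxy nUy] xx']; apply: nUy; apply: CU; rewrite /= -xx'.
move=> x' Wx' y Cxy; apply: contrapT => nUy.
by apply: Wx'; exists (x', y).
Qed.

(** Tightness encloses the section at [x] in an open set of almost the same
    measure, which by [xsect_tube] contains the nearby sections. The function is
    therefore upper semicontinuous. *)
Lemma measurable_xsect_meas C (nu : {measure set (borel Y) -> \bar R}) :
  (nu setT < +oo)%E -> tight nu -> compact C ->
  measurable_fun setT ((fun x => nu [set y | C (x, y)]) : borel X -> \bar R).
Proof.
move=> nufin tnu cC.
apply: (measurability _ (ErealGenInftyO.measurableE R)) => _ /= -[_ [r ->] <-].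
rewrite setTI; apply: borel_open; rewrite openE => x /=.
rewrite in_itv /= => nur.
have cCx : compact [set y | C (x, y)] by exact: compact_xsect.
have mCx := borel_compact hY cCx.
have nuxfin : nu [set y | C (x, y)] \is a fin_num.
  rewrite ge0_fin_numE//.
  by apply: le_lt_trans nufin; apply: le_measure; rewrite ?inE.
have e0 : 0 < r - fine (nu [set y | C (x, y)]).
  by rewrite subr_gt0 -lte_fin fineK.
have [U [oU CU nuU]] := tight_outer hY nufin tnu cCx e0.
have [W [oW Wx] WU] := xsect_tube cC oU CU.
apply: filterS (open_nbhs_nbhs (conj oW Wx)) => x' /WU CU'.
rewrite /= in_itv /=.
apply: (@le_lt_trans _ _ (nu U)).
  apply: le_measure => //; rewrite inE.
    by apply: (borel_compact hY); exact: compact_xsect.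
  exact: borel_open.
apply: lt_le_trans nuU _.
by rewrite -[X in (X + _)%E](fineK nuxfin) -EFinD subrKC.
Qed.

End CompactSections.

Lemma compact_swap {X Y : topologicalType} (C : set (X * Y)) :
  compact C -> compact [set p : Y * X | C (p.2, p.1)].
Proof.
move=> cC.
have -> : [set p : Y * X | C (p.2, p.1)] = @unstable.swap X Y @` C.
  apply/seteqP; split => [[y x] /= Cxy|_ [[x y] /= Cxy <-//]].
  by exists (x, y).
apply: continuous_compact => //.
by apply: continuous_subspaceT; exact: swap_continuous.
Qed.

Section CompactFubini.
Context {X Y : ptopologicalType} {R : realType}.
Hypotheses (hX : hausdorff_space X) (hY : hausdorff_space Y).
Section bound.
Variables (mu : {measure set (borel X) -> \bar R})
  (nu : {measure set (borel Y) -> \bar R}).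
Hypotheses (mufin : (mu setT < +oo)%E) (nufin : (nu setT < +oo)%E).
Hypotheses (tmu : tight mu) (tnu : tight nu).
Variable C : set (X * Y).
Hypothesis cC : compact C.

(** The part of [C] above [S] has iterated integral at most [b]. The function
    that measures its sections is known to be measurable only for special [S],
    hence the majorant [h]. *)
Let ysect_bound (S : set (borel X)) (b : \bar R) :=
  exists h : borel Y -> \bar R, [/\ measurable_fun setT h,
    forall y, (0 <= h y)%E, forall y, (mu (S `&` [set x | C (x, y)]) <= h y)%E &
    (\int[nu]_y h y <= b)%E].

Let ysect_measurable y : measurable ([set x | C (x, y)] : set (borel X)).
Proof. by apply: (borel_compact hX);
  exact: (@compact_xsect Y X hY _ y (compact_swap cC)). Qed.

Let ysect_boundU (S1 S2 : set (borel X)) (b1 b2 : \bar R) :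
  measurable S1 -> measurable S2 ->
  ysect_bound S1 b1 -> ysect_bound S2 b2 -> ysect_bound (S1 `|` S2) (b1 + b2).
Proof.
move=> mS1 mS2 [h1 [mh1 h10 Sh1 ih1]] [h2 [mh2 h20 Sh2 ih2]].
exists (h1 \+ h2)%E; split.
- exact: emeasurable_funD.
- by move=> y; rewrite adde_ge0.
- move=> y; rewrite setIUl; apply: le_trans (leeD (Sh1 y) (Sh2 y)).
  by apply: measureU2; exact: measurableI.
- by rewrite ge0_integralD//; exact: leeD.
Qed.

(** Near each point of [Q] the set [C] lies in a box [W * U] with
    [nu U < c]. Finitely many boxes cover the part of [C] above [Q], and their
    bases can be made disjoint. *)
Let ysect_bound_compact (Q : set X) (c : R) : compact Q ->
  (forall x, Q x -> (nu [set y | C (x, y)] < c%:E)%E) ->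
  ysect_bound Q (c%:E * mu Q).
Proof.
move=> cQ Qc.
(* All measurable parts of the base are included in the property so that two
   bases can be made disjoint in the union step. *)
pose P (Q : set X) := exists A' : set (borel X), [/\ measurable A', Q `<=` A' &
  forall S, measurable S -> S `<=` A' -> ysect_bound S (c%:E * mu S)].
suff [A' [mA' QA' H]] : P Q by apply: H => //; exact: (borel_compact hX).
apply: (compact_ind _ _ _ cQ) => [|A B AB [B' [mB' BB' H]]|A B|x Qx].
- exists set0; split => // S mS; rewrite subset0 => ->.
  exists (cst 0%E); split => // [y|].
    by rewrite set0I measure0.
  by rewrite integral0 measure0 mule0.
- by exists B'; split => //; exact: subset_trans BB'.
- move=> [A' [mA' AA' HA]] [B' [mB' BB' HB]].
  exists (A' `|` B'); split; [exact: measurableU|exact: setUSS|].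
  move=> S mS SAB.
  have mSA : measurable (S `&` A') by exact: measurableI.
  have mSB : measurable (S `\` A') by exact: measurableD.
  have -> : S = (S `&` A') `|` (S `\` A') by rewrite setUIDK.
  rewrite measureU//; last by rewrite setDE setIACA setICr setI0.
  rewrite ge0_muleDr//; apply: ysect_boundU => //.
    by apply: HA => // y [].
  by apply: HB => // y [/SAB[]].
- have cCx : compact [set y | C (x, y)] by exact: compact_xsect.
  have mCx := borel_compact hY cCx.
  have nuxfin : nu [set y | C (x, y)] \is a fin_num.
    rewrite ge0_fin_numE//.
    by apply: le_lt_trans nufin; apply: le_measure; rewrite ?inE.
  have e0 : 0 < c - fine (nu [set y | C (x, y)]).
    by rewrite subr_gt0 -lte_fin fineK// Qc.
  have [U [oU CU nuU]] := tight_outer hY nufin tnu cCx e0.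
  have mU := borel_open oU.
  have [W [oW Wx] WU] := xsect_tube hX cC oU CU.
  exists W; first by exact: (open_nbhs_nbhs (conj oW Wx)).
  exists W; split => //; first exact: borel_open.
  (* above [S] the set [C] is contained in [S * U] *)
  move=> S mS SW; exists (fun y => mu S * (\1_(U : set (borel Y)) y)%:E)%E; split.
  + by apply: measurable_funeM; exact/measurable_EFinP/measurable_indic.
  + by move=> y; rewrite mule_ge0// lee_fin.
  + move=> y; rewrite indicE; have [yU|yU] := pselect (U y).
      rewrite mem_set// mule1; apply: le_measure; rewrite ?inE//.
      exact: measurableI.
    rewrite memNset// mule0.
    suff -> : S `&` [set x0 | C (x0, y)] = set0 by rewrite measure0.
    by apply/seteqP; split => // z [/SW/WU + Czy] => /(_ _ Czy)/yU.
  + rewrite ge0_integralZl//; last first.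
      by apply/measurable_EFinP; exact: measurable_indic.
    rewrite integral_indic// setIT muleC lee_wpmul2r//.
    apply: ltW; apply: lt_le_trans nuU _.
    by rewrite -[X in (X + _)%E](fineK nuxfin) -EFinD subrKC.
Qed.

Let u (x : borel X) := nu [set y | C (x, y)].

Let measurable_u : measurable_fun setT u.
Proof. exact: measurable_xsect_meas. Qed.

Let u_lt c : measurable [set x | (u x < c)%E].
Proof. by rewrite -[X in measurable X]setTI; exact: emeasurable_fun_infty_o. Qed.

Let ysect_bound_mono (S : set (borel X)) (b1 b2 : \bar R) :
  (b1 <= b2)%E -> ysect_bound S b1 -> ysect_bound S b2.
Proof. by move=> b12 [h [mh h0 Sh ih]]; exists h; split => //; exact: le_trans b12. Qed.

Let ysect_bound_small (S : set (borel X)) : measurable S ->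
  ysect_bound S (mu S * nu setT)%E.
Proof.
move=> mS; exists (cst (mu S)); split => // [y|].
  by apply: le_measure; rewrite ?inE//; exact: measurableI.
by rewrite integral_cst.
Qed.

(** On a layer where [u] varies by at most [e], replace the layer by a compact
    subset [Q] with small complement and apply [ysect_bound_compact] to [Q]. *)
Let ysect_bound_layer (S : set (borel X)) (k e eta : R) : measurable S ->
  0 <= k -> 0 < e -> 0 < eta -> (forall x, S x -> (k%:E <= u x < (k + e)%:E)%E) ->
  ysect_bound S (\int[mu]_(x in S) u x + e%:E * mu S + eta%:E)%E.
Proof.
move=> mS k0 e0 eta0 Su.
have nufn : nu setT \is a fin_num by rewrite ge0_fin_numE.
pose M := fine (nu setT); have M0 : 0 <= M by exact: fine_ge0.
have [Q [cQ QS muQ]] := tmu mS (divr_gt0 eta0 (ltr_pwDr ltr01 M0)).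
have mQ := borel_compact hX cQ.
have mSQ : measurable (S `\` Q) by exact: measurableD.
rewrite -(setDUK QS); apply: ysect_boundU => //.
  apply: (@ysect_bound_mono _ ((k + e)%:E * mu Q)%E).
    rewrite setDUK// EFinD ge0_muleDl ?lee_fin ?(ltW e0)//.
    apply: leeD; last first.
      by rewrite lee_wpmul2l ?lee_fin ?(ltW e0)//; apply: le_measure; rewrite ?inE.
    apply: (@le_trans _ _ (k%:E * mu S)%E).
      by rewrite lee_wpmul2l ?lee_fin//; apply: le_measure; rewrite ?inE.
    rewrite -integral_cst//; apply: ge0_le_integral => //.
    - exact: measurable_funTS.
    - by move=> x /Su /andP[].
  by apply: ysect_bound_compact => // x /QS /Su /andP[].
apply: ysect_bound_mono (ysect_bound_small mSQ).
rewrite -(fineK nufn); apply: (@le_trans _ _ ((eta / (M + 1))%:E * M%:E)%E).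
  by rewrite lee_wpmul2r ?lee_fin// ltW.
rewrite -EFinM lee_fin mulrAC ler_pdivrMr ?ltr_pwDr//.
by rewrite ler_wpM2l ?(ltW eta0)// lerDl.
Qed.

Let ysect_bound_lt (e : R) n (eta : R) : 0 < e -> 0 < eta ->
  ysect_bound [set x | (u x < (n%:R * e)%:E)%E]
    (\int[mu]_(x in [set x | (u x < (n%:R * e)%:E)%E]) u x +
     e%:E * mu [set x | (u x < (n%:R * e)%:E)%E] + eta%:E)%E.
Proof.
move=> e0; elim: n eta => [|n IH] eta eta0.
  rewrite mul0r.
  have -> : [set x | (u x < 0%:E)%E] = set0.
    by apply/seteqP; split => // x /=; rewrite ltNge measure_ge0.
  apply: ysect_bound_mono (ysect_bound_small measurable0).
  by rewrite measure0 mul0e integral_set0 mule0 !add0e lee_fin ltW.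
set A := [set x | _]; set B := [set x | (u x < (n%:R * e)%:E)%E] in IH.
have mA : measurable A by exact: u_lt.
have mB : measurable B by exact: u_lt.
have mAB : measurable (A `\` B) by exact: measurableD.
have BA : B `<=` A.
  move=> x /= /lt_le_trans; apply.
  by rewrite lee_fin ler_wpM2r ?(ltW e0)// ler_nat.
have eta20 : 0 < eta / 2 by rewrite divr_gt0.
have disjAB : [disjoint B & A `\` B] by apply/disj_setPS => x [Bx [_]].
have h1 := IH _ eta20.
have h2 : ysect_bound (A `\` B)
  (\int[mu]_(x in A `\` B) u x + e%:E * mu (A `\` B) + (eta / 2)%:E)%E.
  apply: (@ysect_bound_layer _ (n%:R * e)) => //.
    by rewrite mulr_ge0// ltW.
  move=> x [/= Ax /negP]; rewrite -leNgt => ->.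
  by rewrite -{2}[e]mul1r -mulrDl -[1]/(1%:R) -natrD addn1.
have := ysect_boundU mB mAB h1 h2; rewrite setDUK//.
apply: ysect_bound_mono; rewrite -{3 4}(setDUK BA) measureU//; last first.
  by rewrite setDE setICA setICr setI0.
rewrite ge0_integral_setU//; last by apply: measurable_funTS.
rewrite ge0_muleDr// [in leRHS](splitr eta) EFinD.
by rewrite addeACA [X in (X + _ <= _)%E]addeACA.
Qed.

(** Cut [X] into layers [n e <= u < (n + 1) e]. As [nu] is finite, finitely
    many of them cover [X], and their total error is a multiple of [e]. *)
Lemma compact_fubini_le :
  (\int[nu]_y mu [set x | C (x, y)] <= \int[mu]_x u x)%E.
Proof.
apply/lee_addgt0Pr => r r0.
have nufn : nu setT \is a fin_num by rewrite ge0_fin_numE.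
have mufn : mu setT \is a fin_num by rewrite ge0_fin_numE.
pose M := fine (mu setT); have M0 : 0 <= M by exact: fine_ge0.
(* the total error is [e * M + e = r] *)
pose e := r / (M + 1); have e0 : 0 < e by rewrite divr_gt0// ltr_pwDr.
pose n := (Num.truncn (fine (nu setT) / e)).+1.
have nu_lt x : (u x < (n%:R * e)%:E)%E.
  apply: (@le_lt_trans _ _ (nu setT)).
    apply: le_measure; rewrite ?inE//.
    by apply: (borel_compact hY); exact: compact_xsect.
  by rewrite -(fineK nufn) lte_fin -ltr_pdivrMr// truncnS_gt.
have [h [mh h0 Sh ih]] := ysect_bound_lt n e0 e0.
have eT : [set x | (u x < (n%:R * e)%:E)%E] = setT.
  by apply/seteqP; split => // x _; exact: nu_lt.
rewrite eT in Sh ih.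
apply: (@le_trans _ _ (\int[nu]_y h y)%E).
  apply: ge0_le_integral => //; last by move=> y _; rewrite -[X in mu X]setTI.
  exact: (measurable_xsect_meas hY hX mufin tmu (compact_swap cC)).
apply: le_trans ih _.
rewrite -addeA leeD2l// -(fineK mufn) -EFinM -EFinD lee_fin.
by rewrite -{2}[e]mulr1 -mulrDr divfK// gt_eqF// ltr_pwDr.
Qed.

End bound.
End CompactFubini.

Lemma compact_fubini {X Y : ptopologicalType} {R : realType}
    (hX : hausdorff_space X) (hY : hausdorff_space Y)
    (mu : {measure set (borel X) -> \bar R})
    (nu : {measure set (borel Y) -> \bar R}) (C : set (X * Y)) :
  (mu setT < +oo)%E -> (nu setT < +oo)%E -> tight mu -> tight nu -> compact C ->
  (\int[nu]_y mu [set x | C (x, y)] = \int[mu]_x nu [set y | C (x, y)])%E.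
Proof.
move=> mufin nufin tmu tnu cC; apply/eqP; rewrite eq_le; apply/andP; split.
  exact: compact_fubini_le.
exact: (compact_fubini_le hY hX nufin mufin tnu tmu (compact_swap cC)).
Qed.

(** * Borel sets of a topological group *)

Lemma continuous_borel {X Y : ptopologicalType} (f : X -> Y) : continuous f ->
  measurable_fun setT (f : borel X -> borel Y).
Proof.
move=> cf; apply: (@measurability _ _ (borel X) (borel Y) setT f (@open Y) erefl).
move=> _ [B oB <-]; rewrite setTI; apply: borel_open.
by apply: open_comp => // x _; exact: cf.
Qed.

Lemma continuous_borel_real {X : ptopologicalType} {R : realType} (f : X -> R) :
  continuous f -> measurable_fun setT (f : borel X -> R).
Proof.
move=> cf; apply: (measurability _ (RGenOpens.measurableE R)).
move=> _ [_ [a [b -> <-]]]; rewrite setTI; apply: borel_open.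
by apply: open_comp => // x _; exact: cf.
Qed.

Section GroupTopology.
Context {G : topGroupType}.
Implicit Types (A B : set G) (x y z : G).

Lemma mulgl_continuous x : continuous (fun y => x * y)%g.
Proof.
move=> y; apply: (@continuous2_cvg _ _ _ _ _ _ _ _ (fun a b : G => (a * b)%g)).
- exact: (@mulg_continuous G (x, y)).
- exact: cvg_cst.
- exact: cvg_id.
Qed.

Lemma mulgr_continuous x : continuous (fun y => y * x)%g.
Proof.
move=> y; apply: (@continuous2_cvg _ _ _ _ _ _ _ _ (fun a b : G => (a * b)%g)).
- exact: (@mulg_continuous G (y, x)).
- exact: cvg_id.
- exact: cvg_cst.
Qed.

Lemma ltransE x A : ltrans x A = [set y | A (x^-1 * y)%g].
Proof.
apply/seteqP; split => [_ [y Ay <-]/=|y /= Ay]; first by rewrite mulKg.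
by exists (x^-1 * y)%g => //; rewrite mulVKg.
Qed.

Lemma rtransE A x : rtrans A x = [set y | A (y * x^-1)%g].
Proof.
apply/seteqP; split => [_ [y Ay <-]/=|y /= Ay]; first by rewrite mulgK.
by exists (y * x^-1)%g => //; rewrite mulgVK.
Qed.

Definition invset A : set G := [set y | A (y^-1)%g].

Definition mulset A B : set G := [set (p.1 * p.2)%g | p in A `*` B].

Lemma compact_rtrans A x : compact A -> compact (rtrans A x).
Proof.
move=> cA; apply: continuous_compact => //.
by apply: continuous_subspaceT; exact: mulgr_continuous.
Qed.

Lemma compact_ltrans x A : compact A -> compact (ltrans x A).
Proof.
move=> cA; apply: continuous_compact => //.
by apply: continuous_subspaceT; exact: mulgl_continuous.
Qed.

Lemma compact_invset A : compact A -> compact (invset A).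
Proof.
move=> cA.
have -> : invset A = (fun y => y^-1)%g @` A.
  apply/seteqP; split => [y Ay|_ [y Ay <-]]; last by rewrite /invset/= invgK.
  by exists (y^-1)%g => //; rewrite invgK.
apply: continuous_compact => //.
by apply: continuous_subspaceT; exact: invg_continuous.
Qed.

Lemma compact_mulset A B : compact A -> compact B -> compact (mulset A B).
Proof.
move=> cA cB; apply: continuous_compact; last exact: compact_setX.
by apply: continuous_subspaceT; exact: mulg_continuous.
Qed.

Lemma measurable_ltrans x A : measurable (A : set (borel G)) ->
  measurable (ltrans x A : set (borel G)).
Proof.
move=> mA; rewrite ltransE -[X in measurable X]setTI.
exact: (continuous_borel (@mulgl_continuous _)).
Qed.

Lemma measurable_rtrans x A : measurable (A : set (borel G)) ->
  measurable (rtrans A x : set (borel G)).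
Proof.
move=> mA; rewrite rtransE -[X in measurable X]setTI.
exact: (continuous_borel (@mulgr_continuous _)).
Qed.

Lemma measurable_invset A : measurable (A : set (borel G)) ->
  measurable (invset A : set (borel G)).
Proof.
move=> mA; rewrite /invset -[X in measurable X]setTI.
exact: (continuous_borel (@invg_continuous _)).
Qed.

Lemma invsetK A : invset (invset A) = A.
Proof. by apply/funext => y; rewrite /invset/= invgK. Qed.

Lemma rtrans_invset A x : rtrans A x = invset (ltrans (x^-1)%g (invset A)).
Proof.
by rewrite ltransE rtransE; apply/funext => y; rewrite /invset/= invgK invgM invgK.
Qed.

Lemma rtransM A x y : rtrans (rtrans A x) y = rtrans A (x * y)%g.
Proof. by rewrite !rtransE; apply/funext => z /=; rewrite invgM mulgA. Qed.

Lemma rtrans1 A : rtrans A 1%g = A.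
Proof. by rewrite rtransE; apply/funext => z /=; rewrite invg1 mulg1. Qed.

End GroupTopology.

(** * Haar measure on compact sets *)

Section HaarBasic.
Context {R : realType} {G : topGroupType}.
Hypotheses (hG : hausdorff_space G) (sG : sigma_compact [set: G]).
Variable haar : {measure set (borel G) -> \bar R}.
Hypothesis H : left_haar haar.

Let mcpt (K : set G) (cK : compact K) : measurable (K : set (borel G)) :=
  borel_compact hG cK.

Lemma haar_fin_num K : compact K -> haar K \is a fin_num.
Proof. by move=> cK; rewrite ge0_fin_numE//; exact: (haar_compact H). Qed.

(** Haar measure may be infinite; its restrictions to compact sets are finite
    and tight, so that [compact_fubini] applies to them. *)
Definition haar_on (K : set G) (cK : compact K) : {measure set (borel G) -> \bar R} :=
  mrestr haar (borel_compact hG cK).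

Lemma haar_onE K (cK : compact K) E : haar_on cK E = haar (E `&` K).
Proof. by []. Qed.

Lemma haar_on_fin K (cK : compact K) : (haar_on cK setT < +oo)%E.
Proof. by rewrite haar_onE setTI; exact: (haar_compact H). Qed.

(** If the open set [U] contains [K `\` E] and hardly exceeds it, then
    [K `\` U] is a compact subset of [E] that nearly fills [E `&` K]. *)
Lemma tight_haar_on K (cK : compact K) : tight (haar_on cK).
Proof.
move=> E e mE e0; have mK := mcpt cK.
have mKE : measurable ((K `\` E) : set (borel G)) by exact: measurableD.
have KEfin : haar (K `\` E) \is a fin_num.
  rewrite ge0_fin_numE//; apply: le_lt_trans (haar_compact H cK).
  by apply: le_measure; rewrite ?inE//; exact: subDsetl.
have : (ereal_inf [set haar U | U in [set U | open U /\ K `\` E `<=` U]] < haar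
  (K `\` E) + e%:E)%E.
  by rewrite -(haar_outer_regular H mKE) lteDl ?lte_fin.
move=> /ereal_inf_lt[_ [U [oU KEU] <-] Ue].
have mU := borel_open oU.
exists (K `\` U); split.
- by rewrite setDE; apply: compact_closedI => //; exact: open_closedC.
- move=> x [Kx nUx]; apply: contrapT => nEx; apply: nUx; exact: KEU.
- rewrite haar_onE; apply: (@le_lt_trans _ _ (haar (U `\` (K `\` E)))).
    apply: le_measure; rewrite ?inE.
    + by apply: measurableI => //; apply: measurableD => //; exact: measurableD.
    + exact: measurableD.
    + move=> x [[Ex nKU] Kx]; split => [|[]//].
      by apply: contrapT => nUx; apply: nKU.
  rewrite measureD//; last by apply: lt_le_trans Ue _; exact: leey.
  rewrite setIidr// lteBlDl//.
Qed.

Lemma haar_preimage_mull x (E : set (borel G)) : measurable E ->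
  haar [set y : G | E (x * y)%g] = haar E.
Proof.
move=> mE; rewrite -(haar_ltrans H (x^-1)%g mE) ltransE.
by congr (haar _); apply/funext => y /=; rewrite invgK.
Qed.

(** The translates of a null open set would be null, and finitely many of them
    cover any given compact set; by inner regularity [G] itself would be null. *)
Lemma haar_open_gt0 (U : set G) : open U -> U !=set0 -> (0 < haar U)%E.
Proof.
move=> oU [u Uu]; rewrite lt0e measure_ge0 andbT; apply/negP => /eqP U0.
have K0 (K : set G) : compact K -> haar K = 0%E.
  pose P (K : set G) := exists A : set (borel G),
    [/\ measurable A, K `<=` A & haar A = 0%E].
  move=> cK; suff [A [mA KA A0]] : P K.
    exact: (subset_measure0 (mcpt cK) mA KA A0).
  apply: (compact_ind _ _ _ cK) =>
    [|A B AB [C [mC BC C0]]|A B [C [mC AC C0]] [D [mD BD D0]]|x Kx].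
  - by exists set0; split => //; rewrite measure0.
  - by exists C; split => //; exact: subset_trans BC.
  - exists (C `|` D); split; [exact: measurableU|exact: setUSS|].
    by rewrite measureU0.
  - have mU := borel_open oU.
    have oW : open [set y : G | U (u * x^-1 * y)%g].
      by apply: open_comp => // y _; exact: mulgl_continuous.
    exists [set y : G | U (u * x^-1 * y)%g].
      by apply: open_nbhs_nbhs; split => //=; rewrite mulgVK.
    exists [set y : G | U (u * x^-1 * y)%g]; split => //.
      exact: borel_open.
    by rewrite haar_preimage_mull.
have := haar_neq0 H; rewrite (haar_inner_regular H openT).
move/negP; apply; apply/eqP/le_anti/andP; split.
  by apply: ub_ereal_sup => _ [K [cK _] <-]; rewrite K0.
by apply: ereal_sup_ubound; exists set0; rewrite ?measure0//; split => //;
  exact: compact0.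
Qed.

Lemma compact_nbhs1 (W : set G) : nbhs 1%g W ->
  exists V : set G, [/\ compact V, V `<=` W & (0 < haar V)%E].
Proof.
rewrite nbhsE => -[U [oU U1] UW].
have : (0 < haar U)%E by apply: haar_open_gt0 => //; exists 1%g.
rewrite (haar_inner_regular H oU) => /ereal_sup_gt[_ [K [cK KU] <-] K0].
by exists K; split => //; exact: subset_trans UW.
Qed.

Lemma compact_exhaustion : exists K : (set G)^nat,
  [/\ forall n, compact (K n), nondecreasing_seq K & \bigcup_n K n = setT].
Proof.
have [F [cF FT]] := sG.
exists (fun n => \big[setU/set0]_(i < n.+1) F i); split.
- by move=> n; apply: bigsetU_compact.
- by move=> m n mn; apply/subsetPset; apply: subset_bigsetU.
- apply/seteqP; split => // x _; have : [set: G] x by [].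
  rewrite FT => -[n _ Fnx]; exists n => //.
  by rewrite big_ord_recr/=; right.
Qed.

(** [G] is a countable union of compact sets, on each of which
    [tight_exhaustion] applies. *)
Lemma haar_exhaustion (E : set (borel G)) : measurable E ->
  exists C : (set G)^nat, [/\ forall n, compact (C n), nondecreasing_seq C,
    forall n, C n `<=` E & haar (E `\` \bigcup_n C n) = 0%E].
Proof.
move=> mE; have [K [cK _ KT]] := compact_exhaustion.
have /choice[C HC] m := tight_exhaustion hG (tight_haar_on (cK m)) mE.
have cC m n : compact (C m n) by have [] := HC m.
have DE n : \big[setU/set0]_(m < n.+1) C m n = \bigcup_(m < n.+1) C m n.
  by rewrite (bigcup_mkord n.+1 (fun m => C m n)).
exists (fun n => \big[setU/set0]_(m < n.+1) C m n); split.
- by move=> n; apply: bigsetU_compact.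
- move=> i j ij; apply/subsetPset => x; rewrite !DE => -[m /= mi Cx].
  exists m => /=; first exact: leq_trans mi _.
  by have [_ nd _ _] := HC m; move/subsetPset: (nd _ _ ij); exact.
- by move=> n x; rewrite DE => -[m _]; have [_ _ CE _] := HC m; exact: CE.
set D := \bigcup_n _.
have mC m n : measurable (C m n : set (borel G)) by exact: mcpt.
have mU m : measurable (\bigcup_n C m n : set (borel G)) by exact: bigcup_measurable.
have mD : measurable (D : set (borel G)).
  by apply: bigcup_measurable => n _; apply: bigsetU_measurable.
have mEK m : measurable ((E `\` \bigcup_n C m n) `&` K m : set (borel G)).
  by apply: measurableI; [exact: measurableD|exact: mcpt].
apply: (@subset_measure0 _ _ _ haar _
  (\bigcup_m ((E `\` \bigcup_n C m n) `&` K m))).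
- exact: measurableD.
- exact: bigcup_measurable.
- move=> x [Ex nDx]; have : [set: G] x by [].
  rewrite -KT => -[m _ Kx]; exists m => //; split => //; split => // -[n _ Cx].
  apply: nDx; exists (maxn m n) => //.
  rewrite DE; exists m => /=; first by rewrite ltnS leq_maxl.
  by have [_ nd _ _] := HC m; move/subsetPset: (nd _ _ (leq_maxr m n)); exact.
- apply/eqP; rewrite -measure_le0.
  apply: le_trans (measure_sigma_subadditive _ mEK _ (@subset_refl _ _)) _.
    exact: bigcup_measurable.
  by rewrite eseries0// => m _ _; have [_ _ _] := HC m; rewrite haar_onE.
Qed.

Lemma haar_compact_gt0 : exists B : set G, compact B /\ (0 < haar B)%E.
Proof.
have [V [cV _ V0]] := compact_nbhs1 (@filterT _ (nbhs (1%g : G)) _).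
by exists V.
Qed.

(** Apply [compact_fubini] to the pairs [(t, s)] with [s] in [A] and [t s] in
    [B], and to the pairs [(t, b)] with [b] in [B] and [t^-1 b] in [A]. The
    substitution [b = t s] relates their sections at [t], whose [nu]-measures
    agree by hypothesis, and the section of the second set at [b] is
    [b A^-1]. *)
Lemma haar_right_fubini (nu : {measure set (borel G) -> \bar R}) (A B : set G) :
  (nu setT < +oo)%E -> tight nu -> compact A -> compact B ->
  (forall t : G, nu (A `&` [set s | B (t * s)%g]) =
                 nu (B `&` [set b | A (t^-1 * b)%g])) ->
  (\int[nu]_(s in A) haar [set t : G | B (t * (s : G))%g] =
   haar (invset A) * nu B)%E.
Proof.
move=> nufin tnu cA cB nuAB.
have clA := compact_closed hG cA; have clB := compact_closed hG cB.
have cT : compact (mulset B (invset A)).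
  by apply: compact_mulset => //; exact: compact_invset.
(* every [t] that occurs in either set of pairs is in [B A^-1] *)
set T := mulset B (invset A) in cT.
have TB t s : A s -> B (t * s)%g -> T t.
  move=> As Bts; exists ((t * s)%g, s^-1%g) => /=; last by rewrite mulgK.
  by split => //=; rewrite /invset/= invgK.
pose C1 := (T `*` A) `&` [set p : G * G | B (p.1 * p.2)%g].
pose C2 := (T `*` B) `&` [set p : G * G | A (p.1^-1 * p.2)%g].
have cC1 : compact C1.
  apply: compact_closedI; first exact: compact_setX.
  by apply: closed_comp => // p _; exact: mulg_continuous.
have cC2 : compact C2.
  apply: compact_closedI; first exact: compact_setX.
  apply: closed_comp => // p _.
  apply: (@continuous2_cvg _ _ _ _ _ _ _ _ (fun a b : G => (a * b)%g)).
  - exact: (@mulg_continuous G (_, _)).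
  - by apply: continuous_comp; [exact: cvg_fst|exact: invg_continuous].
  - exact: cvg_snd.
have F1 := compact_fubini hG hG (haar_on_fin cT) nufin (tight_haar_on cT) tnu cC1.
have F2 := compact_fubini hG hG (haar_on_fin cT) nufin (tight_haar_on cT) tnu cC2.
have mA := mcpt cA; have mB := mcpt cB.
transitivity (\int[nu]_s haar_on cT [set t | C1 (t, s)])%E.
  rewrite integral_mkcond; apply: eq_integral => s _; rewrite haar_onE patchE.
  case: ifPn => [|]; rewrite ?inE => As.
    congr (haar _); apply/seteqP; split => [t /= Bts|t /= [[[]]]//].
    by have Tt := TB _ _ As Bts.
  transitivity (haar set0); first by rewrite measure0.
  congr (haar _); apply/seteqP; split => // t /= [[[_ /= As']]].
  by move/negP: As; rewrite inE.
rewrite F1; transitivity (\int[haar_on cT]_t nu [set b | C2 (t, b)])%E.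
  apply: eq_integral => t _; have [Tt|nTt] := pselect (T t).
    transitivity (nu (A `&` [set s | B (t * s)%g])).
      by congr (nu _); apply/seteqP; split => s /= [] // [].
    by rewrite nuAB; congr (nu _); apply/seteqP; split => s /= [] // [].
  by congr (nu _); apply/seteqP; split => s /= [[]].
rewrite -F2 -integral_cst// [RHS]integral_mkcond; apply: eq_integral => b _.
rewrite haar_onE patchE; case: ifPn => [|]; rewrite ?inE => Bb.
  rewrite /cst -(haar_preimage_mull (b^-1)%g (measurable_invset (mcpt cA))).
  congr (haar _); apply/seteqP; split => [t /= [[[_ _] /= +] _]|t /=].
    by rewrite /invset/= invgM invgK.
  rewrite /invset/= invgM invgK => Atb.
  suff Tt : T t by [].
  by apply: (TB t (t^-1 * b)%g) => //; rewrite mulVKg.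
transitivity (haar set0); last by rewrite measure0.
congr (haar _); apply/seteqP; split => // t /= [[[_ /= Bb']]].
by move/negP: Bb; rewrite inE.
Qed.

End HaarBasic.

(** * Uniqueness of the invariant measure and the modular function *)

Section Modular.
Context {R : realType} {G : topGroupType}.
Hypotheses (hG : hausdorff_space G) (sG : sigma_compact [set: G]).
Variable haar : {measure set (borel G) -> \bar R}.
Hypothesis H : left_haar haar.

Let mcpt (K : set G) (cK : compact K) : measurable (K : set (borel G)) :=
  borel_compact hG cK.

(** What remains of left invariance after restriction to [L]. *)
Definition locally_invariant (L : set G) (nu : set (borel G) -> \bar R) :=
  forall (t : G) (E : set G), compact E -> E `<=` L -> ltrans t E `<=` L ->
    nu (ltrans t E) = nu E.

Lemma haar_on_invariant L (cL : compact L) : locally_invariant L (haar_on hG haar cL).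
Proof.
move=> t E cE EL tEL; rewrite !haar_onE !setIidl// (haar_ltrans H)//; exact: mcpt.
Qed.

Lemma invariant_right_fubini L (nu : {measure set (borel G) -> \bar R}) (A B : set G) :
  (nu setT < +oo)%E -> tight nu -> locally_invariant L nu ->
  compact A -> compact B -> A `<=` L -> B `<=` L ->
  (\int[nu]_(s in A) haar [set t : G | B (t * (s : G))%g] =
   haar (invset A) * nu B)%E.
Proof.
move=> nufin tnu inv cA cB AL BL; apply: (haar_right_fubini hG H) => // t.
have clB := compact_closed hG cB.
set E := A `&` _.
have -> : B `&` [set b | A (t^-1 * b)%g] = ltrans t E.
  rewrite ltransE; apply/funext => b; apply/propext.
  by rewrite /E /setI/= mulVKg; split => -[].
rewrite inv//; first last.
- by move=> b; rewrite ltransE => -[_ /=]; rewrite mulVKg; exact: BL.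
- by move=> b [/AL].
- by apply: compact_closedI => //; apply: closed_comp => // s _;
  exact: mulgl_continuous.
Qed.

Lemma measurable_right_translate (L B : set G) : compact L -> compact B ->
  measurable_fun (L : set (borel G)) (fun s => haar [set t : G | B (t * (s : G))%g]).
Proof.
move=> cL cB; have clB := compact_closed hG cB.
have cT : compact (mulset B (invset L)).
  by apply: compact_mulset => //; exact: compact_invset.
pose C := (L `*` mulset B (invset L)) `&` [set p : G * G | B (p.2 * p.1)%g].
have cC : compact C.
  apply: compact_closedI; first exact: compact_setX.
  apply: closed_comp => // p _.
  apply: (@continuous2_cvg _ _ _ _ _ _ _ _ (fun a b : G => (a * b)%g)).
  - exact: (@mulg_continuous G (_, _)).
  - exact: cvg_snd.
  - exact: cvg_fst.
have := measurable_xsect_meas hG hG (haar_on_fin hG H cT) (tight_haar_on hG H cT) cC.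
move=> /(@measurable_funTS _ _ _ _ (L : set (borel G))).
apply: eq_measurable_fun => s; rewrite inE => Ls.
rewrite haar_onE; congr (haar _); apply/seteqP; split => [t [[_]]//|t /= Bts].
suff : mulset B (invset L) t by [].
exists ((t * s)%g, s^-1%g) => /=; last by rewrite mulgK.
by split => //=; rewrite /invset/= invgK.
Qed.

(** For a null set [A] the left-hand side of [invariant_right_fubini] vanishes
    with [nu] the Haar measure, whereas [B] can have positive measure. *)
Lemma haar_invset_compact_eq0 (A : set G) : compact A ->
  haar A = 0%E -> haar (invset A) = 0%E.
Proof.
move=> cA A0; have [B [cB B0]] := haar_compact_gt0 hG H.
have cL : compact (A `|` B) by exact: compactU.
have := invariant_right_fubini (haar_on_fin hG H cL) (tight_haar_on hG H cL)
  (haar_on_invariant cL) cA cB (@subsetUl _ _ _) (@subsetUr _ _ _).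
rewrite null_set_integral//; last 3 first.
- exact: mcpt.
- exact: measurable_right_translate.
- by apply/eqP; rewrite haar_onE -measure_le0 -A0; apply: measureIl; apply: mcpt.
move=> /esym /eqP; rewrite mule_eq0 => /orP[/eqP//|].
by rewrite haar_onE setIidl; [move/eqP => B00; rewrite B00 ltxx in B0|exact: subsetUr].
Qed.

(** Inversion changes Haar measure by a density, but null sets are preserved:
    the compact subsets of [invset N] are inverses of compact null sets, and
    they exhaust it up to a null set. *)
Lemma haar_invset_eq0 (N : set G) : measurable (N : set (borel G)) ->
  haar N = 0%E -> haar (invset N) = 0%E.
Proof.
move=> mN N0; have mV := measurable_invset mN.
have [C [cC ndC CN C0]] := haar_exhaustion hG sG H mV.
have mC n : measurable (C n : set (borel G)) by exact: mcpt.
have mUC : measurable (\bigcup_n C n : set (borel G)) by exact: bigcup_measurable.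
have Cn0 n : haar (C n) = 0%E.
  rewrite -[C n]invsetK; apply: haar_invset_compact_eq0.
    exact: compact_invset.
  apply: (subset_measure0 _ mN) N0; first exact: measurable_invset.
  by move=> x /CN; rewrite /invset/= invgK.
have UC0 : haar (\bigcup_n C n) = 0%E.
  apply/eqP; rewrite -measure_le0.
  apply: le_trans (measure_sigma_subadditive _ mC mUC (@subset_refl _ _)) _.
  by rewrite eseries0.
apply: (@subset_measure0 _ _ _ haar _
  ((\bigcup_n C n) `|` (invset N `\` \bigcup_n C n))).
- by [].
- by apply: measurableU => //; exact: measurableD.
- by move=> x Nx; have [?|?] := pselect ((\bigcup_n C n) x); [left|right].
- have mD : measurable (invset N `\` \bigcup_n C n : set (borel G)).
    exact: measurableD.
  exact: etrans (measureU0 mUC mD C0) UC0.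
Qed.

Lemma haar_rtrans_eq0 (N : set G) z : measurable (N : set (borel G)) ->
  haar N = 0%E -> haar (rtrans N z) = 0%E.
Proof.
move=> mN N0; rewrite rtrans_invset; apply: haar_invset_eq0.
  by apply: measurable_ltrans; exact: measurable_invset.
rewrite (haar_ltrans H); first exact: haar_invset_eq0.
exact: measurable_invset.
Qed.

Lemma haar_rtrans_gt0 (E : set G) z : measurable (E : set (borel G)) ->
  (0 < haar E)%E -> (0 < haar (rtrans E z))%E.
Proof.
move=> mE; rewrite !lt0e !measure_ge0 !andbT; apply: contra => /eqP E0.
rewrite -[E]rtrans1 -(mulgV z) -rtransM; apply/eqP/haar_rtrans_eq0 => //.
exact: measurable_rtrans.
Qed.

Lemma haar_invset_gt0 (E : set G) : measurable (E : set (borel G)) ->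
  (0 < haar E)%E -> (0 < haar (invset E))%E.
Proof.
move=> mE; rewrite !lt0e !measure_ge0 !andbT; apply: contra => /eqP E0.
by rewrite -[E]invsetK; apply/eqP/haar_invset_eq0 => //; exact: measurable_invset.
Qed.

(** By [invariant_right_fubini] with [nu] the Haar measure, both sides have
    integral |A^-1| |B| |B'| over every compact subset [A] of [L], hence the same
    integral over every Borel subset. *)
Lemma right_translate_proportional (L B B' : set G) (cL : compact L) :
  compact B -> compact B' -> B `<=` L -> B' `<=` L ->
  ae_eq (haar_on hG haar cL) (L : set (borel G))
    (fun s => haar B' * haar [set t : G | B (t * (s : G))%g])%E
    (fun s => haar B * haar [set t : G | B' (t * (s : G))%g])%E.
Proof.
move=> cB cB' BL B'L.
have fl := haar_on_fin hG H cL; have tl := tight_haar_on hG H cL.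
have il := haar_on_invariant cL.
have mf D : compact D -> measurable_fun (L : set (borel G))
    (fun s => haar [set t : G | D (t * (s : G))%g]).
  by move=> cD; exact: measurable_right_translate.
have int A D : compact A -> compact D -> A `<=` L -> D `<=` L ->
    (\int[haar_on hG haar cL]_(s in A) haar [set t : G | D (t * (s : G))%g] =
     haar (invset A) * haar D)%E.
  move=> cA cD AL DL; rewrite (invariant_right_fubini fl tl il cA cD AL DL).
  by rewrite haar_onE setIidl.
have intZ c A D : (0 <= c)%E -> compact A -> compact D -> A `<=` L -> D `<=` L ->
    (\int[haar_on hG haar cL]_(s in A) (c * haar [set t : G | D (t * (s : G))%g]) =
     c * (haar (invset A) * haar D))%E.
  move=> c0 cA cD AL DL; rewrite ge0_integralZl//; first by rewrite int.
    exact: mcpt.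
  exact: (measurable_funS (mcpt cL) AL (mf _ cD)).
apply: integral_ae_eq.
- exact: mcpt.
- apply/integrableP; split; first by apply: measurable_funeM; exact: mf.
  under eq_integral do rewrite gee0_abs ?mule_ge0//.
  rewrite intZ//.
  rewrite ltey_eq fin_numM//; first exact: haar_fin_num.
  by rewrite fin_numM//; apply: (haar_fin_num H) => //; exact: compact_invset.
- by apply: measurable_funeM; exact: mf.
move=> E EL mE.
have [C [cC ndC CE C0]] := tight_exhaustion hG tl mE.
have mC n : measurable (C n : set (borel G)) by exact: mcpt.
have mUC : measurable (\bigcup_n C n : set (borel G)) by exact: bigcup_measurable.
have mEC : measurable (E `\` \bigcup_n C n : set (borel G)) by exact: measurableD.
have UCE : E `\` (E `\` \bigcup_n C n) = \bigcup_n C n.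
  by rewrite setDD setIidr// => x [n _]; exact: CE.
have CL n : C n `<=` L by move=> x /CE /EL.
have red (f : borel G -> \bar R) : measurable_fun (L : set (borel G)) f ->
  (forall x, 0 <= f x)%E ->
    (\int[haar_on hG haar cL]_(s in E) f s =
     \int[haar_on hG haar cL]_(s in \bigcup_n C n) f s)%E.
  move=> mfL f0.
  rewrite (@ge0_negligible_integral _ _ _ _ E (E `\` \bigcup_n C n))//.
    by rewrite UCE.
  exact: (measurable_funS (mcpt cL) EL mfL).
have cvgC (f : borel G -> \bar R) : measurable_fun (L : set (borel G)) f ->
  (forall x, 0 <= f x)%E ->
    (\int[haar_on hG haar cL]_(s in C n) f s)%E @[n --> \oo] -->
    (\int[haar_on hG haar cL]_(s in E) f s)%E.
  move=> mfL f0; rewrite red//; apply: ge0_nondecreasing_set_cvg_integral => //.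
  by move=> n; exact: (measurable_funS (mcpt cL) (CL n) mfL).
set f := (X in (\int[_]_(x in _) X x = _)%E); set g :=
  (X in (_ = \int[_]_(x in _) X x)%E).
have mfL : measurable_fun (L : set (borel G)) f by apply: measurable_funeM; exact: mf.
have mgL : measurable_fun (L : set (borel G)) g by apply: measurable_funeM; exact: mf.
have f0 x : (0 <= f x)%E by rewrite mule_ge0.
have g0 x : (0 <= g x)%E by rewrite mule_ge0.
apply: (cvg_unique _ (cvgC f mfL f0)); first exact: ereal_hausdorff.
rewrite (_ : (fun n => _) = fun n => (\int[haar_on hG haar cL]_(s in C n) g s)%E).
  exact: cvgC.
apply/funext => n; rewrite !intZ//.
by rewrite muleCA [RHS]muleCA (muleC (haar B)).
Qed.

(** Uniqueness of the left invariant measure, in a local form that suits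
    measures known only inside a compact set. Integrate the almost everywhere
    equality of [right_translate_proportional] over [A] against [nu]; by
    [invariant_right_fubini] the result is |A^-1| |B'| nu(B) = |A^-1| |B| nu(B'),
    and |A^-1| is positive. *)
Lemma left_invariant_proportional (nu : {measure set (borel G) -> \bar R})
    (A B B' L : set G) (cL : compact L) : (nu setT < +oo)%E ->
  (forall E : set (borel G), measurable E -> haar (E `&` L) = 0 -> nu E = 0)%E ->
  locally_invariant L nu ->
  compact A -> compact B -> compact B' -> A `<=` L -> B `<=` L -> B' `<=` L ->
  (0 < haar A)%E -> (haar B' * nu B = haar B * nu B')%E.
Proof.
move=> nufin numu inv cA cB cB' AL BL B'L A0.
have tnu : tight nu.
  by apply: (tight_dominates hG (tight_haar_on hG H cL)) => // E mE; exact: numu.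
have mf D : compact D -> measurable_fun (A : set (borel G))
    (fun s => haar [set t : G | D (t * (s : G))%g]).
  move=> cD; exact: (measurable_funS (mcpt cL) AL (measurable_right_translate cL cD)).
have : (\int[nu]_(s in A) (haar B' * haar [set t : G | B (t * (s : G))%g]) =
        \int[nu]_(s in A) (haar B * haar [set t : G | B' (t * (s : G))%g]))%E.
  apply: ae_eq_integral.
  - exact: mcpt.
  - by apply: measurable_funeM; exact: mf.
  - by apply: measurable_funeM; exact: mf.
  have [N [mN N0 NP]] := right_translate_proportional cL cB cB' BL B'L.
  exists N; split => //; first by apply: numu => //;
    rewrite -[LHS](haar_onE hG haar cL).
  move=> s ns; apply: NP => /= sL; apply: ns => /= As; apply: sL; exact: AL.
rewrite !ge0_integralZl//; [|exact: mcpt|exact: mf|exact: mcpt|exact: mf].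
rewrite !(invariant_right_fubini nufin tnu inv)//.
have cAi := compact_invset cA.
have nuf (E : set (borel G)) : measurable E -> nu E \is a fin_num.
  move=> mE; rewrite ge0_fin_numE//; apply: le_lt_trans nufin.
  by apply: le_measure; rewrite ?inE.
have cAi0 : fine (haar (invset A)) != 0.
  rewrite fine_eq0; first by rewrite -measure_gt0 haar_invset_gt0//; exact: mcpt.
  exact: (haar_fin_num H).
rewrite muleCA [X in _ = X -> _]muleCA.
rewrite -(fineK (haar_fin_num H cAi)) -(fineK (haar_fin_num H cB)).
rewrite -(fineK (haar_fin_num H cB')) -(fineK (nuf _ (mcpt cB)))
  -(fineK (nuf _ (mcpt cB'))).
by rewrite -!EFinM => -[/(mulfI cAi0) ->].
Qed.

Definition haar_right (z : G) : set (borel G) -> \bar R := fun E => haar (rtrans E z).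

Section HaarRight.
Variable z : G.

Let haar_right0 : haar_right z set0 = 0%E.
Proof. by rewrite /haar_right /rtrans image_set0 measure0. Qed.

Let haar_right_ge0 E : (0 <= haar_right z E)%E.
Proof. by []. Qed.

Let haar_right_sigma_additive : semi_sigma_additive (haar_right z).
Proof.
move=> F mF tF mUF; rewrite /haar_right.
have -> : rtrans (\bigcup_n F n) z = \bigcup_n rtrans (F n) z.
  by rewrite /rtrans image_bigcup.
apply: (@measure_semi_sigma_additive _ _ _ haar (fun n => rtrans (F n) z)).
- by move=> n; exact: measurable_rtrans.
- apply/trivIsetP => i j _ _ ij; apply/seteqP; split => // x.
  rewrite !rtransE => -[/= Fi Fj].
  suff : (F i `&` F j) (x / z)%g by move/trivIsetP : tF => ->.
  by split.
- by apply: bigcup_measurable => n _; exact: measurable_rtrans.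
Qed.

HB.instance Definition _ := isMeasure.Build _ _ _ (haar_right z)
  haar_right0 haar_right_ge0 haar_right_sigma_additive.

End HaarRight.

(** Left and right translations commute, so [haar_right z] is left
    invariant. *)
Lemma haar_right_compact z (B B' : set G) : compact B -> compact B' ->
  (haar B' * haar (rtrans B z) = haar B * haar (rtrans B' z))%E.
Proof.
move=> cB cB'; have [A [cA A0]] := haar_compact_gt0 hG H.
(* a compact set large enough for the measures compared to live on it *)
pose L := A `|` (B `|` B').
have cL : compact L by apply: compactU => //; exact: compactU.
pose nu := mrestr (haar_right z) (mcpt cL).
have nuE E : E `<=` L -> nu E = haar (rtrans E z).
  by move=> EL; rewrite /nu /mrestr setIidl.
have BL : B `<=` L by move=> x Bx; right; left.
have B'L : B' `<=` L by move=> x Bx; right; right.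
have AL : A `<=` L by move=> x Bx; left.
rewrite -!nuE//.
apply: (@left_invariant_proportional nu A B B' L cL) => //.
- rewrite /= /mrestr setTI; apply: (haar_compact H); exact: compact_rtrans.
- move=> E mE EL0; rewrite /= /mrestr; apply: haar_rtrans_eq0 => //.
  by apply: measurableI => //; exact: mcpt.
- rewrite /locally_invariant => t E cE EL tEL; rewrite [LHS]nuE// [RHS]nuE//.
  have -> : rtrans (ltrans t E) z = ltrans t (rtrans E z).
    by rewrite !rtransE !ltransE; apply/funext => x /=; rewrite mulgA.
  by rewrite (haar_ltrans H)//; apply: measurable_rtrans; exact: mcpt.
Qed.

(** The value at [z] is the ratio |B z| / |B| for a fixed compact [B]. Other
    compact sets have the same ratio by uniqueness, and Borel sets are exhausted
    by compact ones. *)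
Lemma modular_function : exists D : G -> R, [/\ forall z, 0 < D z,
  forall x y, D (x * y)%g = D x * D y &
  forall z (E : set (borel G)), measurable E ->
    haar (rtrans E z) = ((D z)%:E * haar E)%E].
Proof.
have [B [cB B0]] := haar_compact_gt0 hG H.
have Bf := haar_fin_num H cB.
have fB0 : 0 < fine (haar B) by rewrite fine_gt0// B0/= -ge0_fin_numE.
have cBz z : compact (rtrans B z) by exact: compact_rtrans.
have Bzf z := haar_fin_num H (cBz z).
pose D z := fine (haar (rtrans B z)) / fine (haar B).
have Dcompact z K : compact K -> haar (rtrans K z) = ((D z)%:E * haar K)%E.
  move=> cK; have Kf := haar_fin_num H cK; have cKz : compact (rtrans K z) by
    exact: compact_rtrans.
  have Kzf := haar_fin_num H cKz.
  have := haar_right_compact z cB cK.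
  rewrite -(fineK Bf) -(fineK Kf) -(fineK (Bzf z)) -(fineK Kzf) -!EFinM => -[E].
  by congr EFin; rewrite /D mulrAC [_ * fine (haar K)]mulrC E mulrAC divff ?mul1r//
    gt_eqF.
exists D; split.
- move=> z; rewrite divr_gt0// fine_gt0// -ge0_fin_numE// Bzf andbT.
  by apply: haar_rtrans_gt0 => //; exact: mcpt.
- move=> x y; rewrite {1}/D -rtransM Dcompact// -(fineK (Bzf x)) -EFinM/=.
  by rewrite -mulrA mulrC.
- move=> z E mE; have [C [cC ndC CE C0]] := haar_exhaustion hG sG H mE.
  have mC n : measurable (C n : set (borel G)) by exact: mcpt.
  have mUC : measurable (\bigcup_n C n : set (borel G)) by exact: bigcup_measurable.
  have mEC : measurable (E `\` \bigcup_n C n : set (borel G)) by exact: measurableD.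
  have UCE : \bigcup_n C n `<=` E by move=> x [n _]; exact: CE.
  have red (nu : {measure set (borel G) -> \bar R}) : nu (E `\` \bigcup_n C n) = 0%E ->
      nu (C n) @[n --> \oo] --> nu E.
    move=> nu0; have -> : nu E = nu (\bigcup_n C n).
      by rewrite -[in LHS](setDUK UCE) measureU0.
    exact: nondecreasing_cvg_mu.
  have h1 := red haar C0.
  have h2 : haar_right z (C n) @[n --> \oo] --> haar_right z E.
    by apply: red => /=; exact: haar_rtrans_eq0.
  apply: (cvg_unique _ h2); first exact: ereal_hausdorff.
  rewrite (_ : (fun n => haar_right z (C n)) = fun n => ((D z)%:E * haar (C n))%E);
    last first.
    by apply/funext => n; rewrite /haar_right Dcompact.
  exact: cvgeZl.
Qed.

End Modular.

(** * Density of the indicators of compact sets *)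

Section L1.
Import HBSimple.
Context {R : realType} {G : topGroupType}.
Hypotheses (hG : hausdorff_space G) (sG : sigma_compact [set: G]).
Variable haar : {measure set (borel G) -> \bar R}.
Hypothesis H : left_haar haar.

Let mcpt (K : set G) (cK : compact K) : measurable (K : set (borel G)) :=
  borel_compact hG cK.

(** A predicate on plain functions, so that translates, sums and convolutions
    need not be packed into the type of integrable functions. *)
Definition l1 (f : borel G -> R) := haar.-integrable setT (EFin \o f).

Definition nrm1 (f : borel G -> R) : R := \int[haar]_x `|f x|.

Implicit Types f g h : borel G -> R.

Lemma l1D f g : l1 f -> l1 g -> l1 (f \+ g).
Proof. by move=> lf lg; exact: (integrableD measurableT lf lg). Qed.

Lemma l1B f g : l1 f -> l1 g -> l1 (f \- g).
Proof. by move=> lf lg; exact: (integrableB measurableT lf lg). Qed.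

Lemma l1Z (a : R) f : l1 f -> l1 (fun x => a * f x).
Proof. by move=> lf; exact: (integrableZl measurableT a lf). Qed.

Lemma l1_norm f : l1 f -> l1 (fun x => `|f x|).
Proof. by move=> lf; exact: integrable_norm. Qed.

Lemma l1_measurable f : l1 f -> measurable_fun setT f.
Proof. by move=> /integrableP[/measurable_EFinP]. Qed.

Lemma nrm1_ge0 f : 0 <= nrm1 f.
Proof. by apply: Rintegral_ge0. Qed.

Lemma nrm1D f g : l1 f -> l1 g -> nrm1 (f \+ g) <= nrm1 f + nrm1 g.
Proof.
move=> lf lg; rewrite /nrm1 -RintegralD//; [|exact: l1_norm..].
apply: le_Rintegral => //.
- exact/l1_norm/l1D.
- by apply: l1D; exact: l1_norm.
- by move=> x _; exact: ler_normD.
Qed.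

Lemma nrm1Z a f : l1 f -> nrm1 (fun x => a * f x) = `|a| * nrm1 f.
Proof.
move=> lf; rewrite /nrm1 -RintegralZl//; last exact: l1_norm.
by apply: eq_Rintegral => x _; rewrite normrM.
Qed.

Lemma Rintegral_le_nrm1 f : l1 f -> `|\int[haar]_x f x| <= nrm1 f.
Proof. by move=> lf; exact: le_normr_Rintegral. Qed.

Lemma l1_indic (E : set (borel G)) : measurable E -> (haar E < +oo)%E -> l1 (\1_E).
Proof.
move=> mE Ef; apply/integrableP; split.
  by apply/measurable_EFinP; exact: measurable_indic.
under eq_integral do rewrite gee0_abs ?lee_fin//.
by rewrite integral_indic// setIT.
Qed.

Lemma Rintegral_indicT (E : set (borel G)) : measurable E ->
  \int[haar]_x (\1_E : borel G -> R) x = fine (haar E).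
Proof. by move=> mE; rewrite /Rintegral integral_indic// setIT. Qed.

Lemma nrm1_indic (E : set (borel G)) : measurable E ->
  nrm1 (\1_E) = fine (haar E).
Proof.
move=> mE; rewrite /nrm1 -Rintegral_indicT//.
by apply: eq_Rintegral => x _; rewrite ger0_norm.
Qed.

(** The indicator of a Borel set of finite measure is a limit of indicators of
    compact sets, a simple function is a combination of such indicators, and an
    integrable function is a limit of simple functions. *)
Lemma l1_ind (P : (borel G -> R) -> Prop) :
  (forall B : set G, compact B -> P \1_(B : set (borel G))) ->
  (forall f g, l1 f -> l1 g -> P f -> P g -> P (f \+ g)) ->
  (forall a f, l1 f -> P f -> P (fun x => a * f x)) ->
  (forall f, l1 f -> (forall e, 0 < e -> exists g, [/\ l1 g, P g & nrm1 (f \- g) < e])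
    -> P f) ->
  forall f, l1 f -> P f.
Proof.
move=> Pc PD PZ Pcl.
have Pfin (E : set (borel G)) : measurable E -> (haar E < +oo)%E -> P \1_E.
  move=> mE Ef; apply: Pcl; first exact: l1_indic.
  move=> e e0; have [C [cC ndC CE C0]] := haar_exhaustion hG sG H mE.
  have mC n : measurable (C n : set (borel G)) by exact: mcpt.
  have mUC : measurable (\bigcup_n C n : set (borel G)) by exact: bigcup_measurable.
  have UCE : \bigcup_n C n `<=` E by move=> x [n _]; exact: CE.
  have cvgC : haar (C n) @[n --> \oo] --> haar E.
    have -> : haar E = haar (\bigcup_n C n).
      rewrite -[in LHS](setDUK UCE) measureU0//.
      by apply: (@measurableD _ (borel G)).
    exact: nondecreasing_cvg_mu.
  have Efn : haar E \is a fin_num by rewrite ge0_fin_numE.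
  move: cvgC; rewrite -(fineK Efn) => /fine_cvgP[_ /cvgrPdist_lt /(_ _ e0)[n _ Hn]].
  exists (\1_(C n : set (borel G))); split.
  - by apply: l1_indic => //; exact: (haar_compact H).
  - exact: Pc.
  have -> : \1_E \- \1_(C n) = \1_(E `\` C n) :> (borel G -> R).
    apply/funext => x /=; rewrite !indicE in_setD.
    have [xC|xC] := boolP (x \in C n); last by rewrite andbT subr0.
    by rewrite andbF (_ : x \in E) ?subrr//; move: xC; rewrite !inE; exact: CE.
  rewrite nrm1_indic; last exact: measurableD.
  rewrite measureD// setIidr// fineB//; last exact: haar_fin_num.
  by apply: le_lt_trans (Hn n (leqnn n)); exact: ler_norm.
have P0 : P (cst 0).
  have := Pc _ compact0; congr P; apply/funext => x.
  by rewrite indicE in_set0.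
have Psum I (r : seq I) (F : I -> borel G -> R) :
    (forall i, l1 (F i) /\ P (F i)) ->
    l1 (fun x => \sum_(i <- r) F i x) /\ P (fun x => \sum_(i <- r) F i x).
  move=> HF; elim: r => [|i r [IH1 IH2]].
    under eq_fun do rewrite big_nil.
    by split => //; exact: integrable0.
  under eq_fun do rewrite big_cons.
  have [h1 h2] := HF i.
  by split; [exact: l1D|exact: PD].
have Psfun (f : {sfun borel G >-> R}) : l1 f -> P f.
  move=> lf; rewrite (_ : (f : _ -> _) = fun x =>
    \sum_(y \in range f) y * \1_(f @^-1` [set y]) x); last first.
    by apply/funext => x; exact: fimfunE.
  under eq_fun do rewrite fsbig_finite//.
  apply: (Psum _ _ (fun y x => y * \1_(f @^-1` [set y]) x) _).2 => y.
  have mfy : measurable (f @^-1` [set y] : set (borel G)) by exact: measurable_sfunP.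
  have [->|y0] := eqVneq y 0.
    by under eq_fun do rewrite mul0r; split => //; exact: integrable0.
  have fyf : (haar (f @^-1` [set y]) < +oo)%E.
    have /integrableP[_] := lf; apply: contraTT; rewrite -!leNgt !leye_eq => /eqP fyE.
    rewrite -leye_eq; apply: (@le_trans _ _
      (\int[haar]_x (`|y| * \1_(f @^-1` [set y]) x)%:E)%E).
      under eq_integral do rewrite EFinM.
      rewrite ge0_integralZl//.
      - rewrite integral_indic// setIT fyE.
        by rewrite gt0_muley// lte_fin normr_gt0.
      - by apply/measurable_EFinP; exact: measurable_indic.
    apply: ge0_le_integral => //.
    - by apply/measurable_EFinP; apply: measurable_funM => //; exact: measurable_indic.
    - by apply/measurable_EFinP; apply: measurableT_comp => //.
    - move=> x _ /=; rewrite lee_fin indicE.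
      have [|_] := boolP (x \in _); last by rewrite mulr0.
      by rewrite inE/= => ->; rewrite mulr1.
  have ly := l1_indic mfy fyf.
  by split; [exact: l1Z|apply: PZ => //; exact: Pfin].
move=> f lf; apply: Pcl => // e e0.
have [g_ [lg _]] := approximation_sfun_integrable measurableT lf.
move=> /fine_cvgP[_ /cvgrPdist_lt /(_ _ e0)[n _ Hn]].
exists (g_ n); split; [exact: lg|exact/Psfun/lg|].
have := Hn n (leqnn n); rewrite sub0r normrN ger0_norm//.
by apply: fine_ge0; apply: integral_ge0.
Qed.

End L1.

(** * Translation and convolution *)

Section Translation.
Context {R : realType} {G : topGroupType}.
Hypotheses (hG : hausdorff_space G) (sG : sigma_compact [set: G]).
Variable haar : {measure set (borel G) -> \bar R}.
Hypothesis H : left_haar haar.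

Let mcpt (K : set G) (cK : compact K) : measurable (K : set (borel G)) :=
  borel_compact hG cK.

Local Notation l1 := (l1 haar).
Local Notation nrm1 := (nrm1 haar).
Implicit Types f g h : borel G -> R.

Definition ltransf (s : G) f : borel G -> R := fun y => f (s^-1 * (y : G))%g.

Let mleft (s : G) : measurable_fun [set: borel G]
  (fun y : borel G => (s * (y : G))%g : borel G).
Proof. by apply: continuous_borel; exact: mulgl_continuous. Qed.

Lemma measurable_ltransf s f : measurable_fun setT f ->
  measurable_fun setT (ltransf s f).
Proof. by move=> mf; exact: (measurableT_comp mf (mleft _)). Qed.

Let pushE (s : G) (A : set (borel G)) : measurable A -> A `<=` setT ->
  pushforward haar (fun y : borel G => (s * (y : G))%g : borel G) A = haar A.
Proof. by move=> mA _; exact: (haar_preimage_mull H). Qed.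

Lemma ge0_integral_ltransf s (f : borel G -> \bar R) : measurable_fun setT f ->
  (forall x, 0 <= f x)%E ->
  (\int[haar]_x f (s^-1 * (x : G))%g = \int[haar]_x f x)%E.
Proof.
move=> mf f0.
have := @ge0_integral_pushforward _ _ _ _ _ _ (mleft (s^-1)%g) haar setT f measurableT
  mf (fun y _ => f0 y).
rewrite preimage_setT => <-.
by apply: eq_measure_integral => A mA AT; exact: pushE.
Qed.

Lemma l1_ltransf s f : l1 f -> l1 (ltransf s f).
Proof.
move=> lf; have mf := l1_measurable lf; apply/integrableP; split.
  by apply/measurable_EFinP; exact: measurable_ltransf.
rewrite (@ge0_integral_ltransf s (fun x => `|(f x)%:E|%E))//.
- by have /integrableP[] := lf.
- by apply/measurable_EFinP; exact: measurableT_comp.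
Qed.

Lemma Rintegral_ltransf s f : l1 f -> \int[haar]_x ltransf s f x = \int[haar]_x f x.
Proof.
move=> lf; have mf := l1_measurable lf.
have meF : measurable_fun setT (EFin \o f) by exact/measurable_EFinP.
rewrite /Rintegral; congr fine.
have lfs := l1_ltransf s lf.
have := @integral_pushforward _ _ _ _ _ _ (mleft (s^-1)%g) haar setT (EFin \o f) meF.
rewrite preimage_setT => /(_ lfs measurableT) <-.
by apply: eq_measure_integral => A mA AT; exact: pushE.
Qed.

Lemma nrm1_ltransf s f : l1 f -> nrm1 (ltransf s f) = nrm1 f.
Proof. by move=> lf; rewrite /nrm1 -(Rintegral_ltransf s (l1_norm lf)). Qed.

Lemma ltransf_compact_near (B U : set G) : compact B -> open U -> B `<=` U ->
  \forall s \near (1%g : G), ltrans s B `<=` U.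
Proof.
move=> cB oU BU.
have /compact_near_coveringP ncB := cB.
have Hn := ncB G (nbhs (1%g : G)) (fun s b => U (s * b)%g) _.
apply: filterS (Hn (nbhs_filter _) _) => [s Us _ [b Bb <-]|b Bb]; first exact: Us.
have c : (fun p : G * G => (p.2 * p.1)%g) z @[z --> (b, 1%g)] --> (1 * b : G)%g.
    apply: (@continuous2_cvg _ _ _ _ _ _ _ _ (fun a b : G => (a * b)%g)).
    - exact: (@mulg_continuous G (_, _)).
    - exact: cvg_snd.
    - exact: cvg_fst.
apply: c; rewrite mul1g; apply: open_nbhs_nbhs; split => //; exact: BU.
Qed.

Lemma haar_outer_compact (B : set G) (e : R) : compact B -> 0 < e ->
  exists U : set G, [/\ open U, B `<=` U & (haar U < haar B + e%:E)%E].
Proof.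
move=> cB e0.
have : (ereal_inf [set haar U | U in [set U | open U /\ B `<=` U]] < haar B + e%:E)%E.
  by rewrite -(haar_outer_regular H (mcpt cB)) lteDl ?lte_fin//;
    exact: (haar_fin_num H).
by move=> /ereal_inf_lt[_ [U [oU BU] <-] Ue]; exists U.
Qed.

Lemma ltransf_indic s (B : set G) :
  ltransf s \1_(B : set (borel G)) = \1_(ltrans s B : set (borel G)).
Proof. by apply/funext => x; rewrite /ltransf !indicE ltransE. Qed.

(** Let [U] be an open set around [B] of almost the same measure. For [s]
    near 1, both [B] and its translate are contained in [U] and have the same
    measure, so each is almost all of [U]. *)
Lemma ltransf_indic_continuous (B : set G) (e : R) : compact B -> 0 < e ->
  \forall s \near (1%g : G), nrm1
    (ltransf s \1_(B : set (borel G)) \- \1_(B : set (borel G))) < e.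
Proof.
move=> cB e0; have e20 : 0 < e / 2 by rewrite divr_gt0.
have [U [oU BU Ue]] := haar_outer_compact cB e20.
apply: filterS (ltransf_compact_near cB oU BU) => s sBU.
have cA : compact (ltrans s B) by exact: compact_ltrans.
rewrite ltransf_indic; set A := ltrans s B in sBU cA *.
have mA := mcpt cA; have mB := mcpt cB; have mU := borel_open oU.
have haarA : haar A = haar B by exact: (haar_ltrans H).
have mAB : measurable (A `\` B : set (borel G)) by exact: measurableD.
have mBA : measurable (B `\` A : set (borel G)) by exact: measurableD.
have Ufin : (haar U < +oo)%E by apply: lt_le_trans Ue _; exact: leey.
have bound (X Y : set (borel G)) : measurable X -> measurable Y -> X `<=` U ->
    Y `<=` U -> haar Y = haar B -> (haar (X `\` Y) < (e / 2)%:E)%E.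
  move=> mX mY XU YU hY; apply: (@le_lt_trans _ _ (haar (U `\` Y))).
    by apply: le_measure; rewrite ?inE;
      [exact: measurableD|exact: measurableD|exact: setSD].
  have -> : haar (U `\` Y) = (haar U - haar B)%E.
    by rewrite measureD// setIidr//; congr (_ - _)%E.
  by rewrite lteBlDl//; exact: (haar_fin_num H).
have b1 := bound A B mA mB sBU BU erefl.
have b2 := bound B A mB mA BU sBU haarA.
have f1 : haar (A `\` B) \is a fin_num by rewrite ge0_fin_numE//; apply: lt_trans b1 _;
  exact: ltry.
have f2 : haar (B `\` A) \is a fin_num by rewrite ge0_fin_numE//; apply: lt_trans b2 _;
  exact: ltry.
have -> : nrm1 (\1_(A : set (borel G)) \- \1_(B : set (borel G))) =
    fine (haar (A `\` B)) + fine (haar (B `\` A)).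
  rewrite -!Rintegral_indicT// -RintegralD//; last 2 first.
  - by apply: l1_indic => //; rewrite -ge0_fin_numE.
  - by apply: l1_indic => //; rewrite -ge0_fin_numE.
  apply: eq_Rintegral => x _ /=; rewrite !indicE !in_setD.
  case: (x \in A); case: (x \in B);
    rewrite /= ?subrr ?subr0 ?sub0r ?normrN ?normr0 ?normr1 ?addr0 ?add0r//.
by rewrite (splitr e) ltrD// -lte_fin fineK.
Qed.

(** Translations are isometries of L^1, so continuity extends from the
    indicators of compact sets to their closed linear span. *)
Lemma ltransf_continuous f : l1 f -> forall e : R, 0 < e ->
  \forall s \near (1%g : G), nrm1 (ltransf s f \- f) < e.
Proof.
pose P f := forall e : R, 0 < e ->
  \forall s \near (1%g : G), nrm1 (ltransf s f \- f) < e.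
apply: (@l1_ind _ _ hG sG _ H P) => {f}; rewrite /P.
- by move=> B cB e e0; exact: ltransf_indic_continuous.
- move=> f g lf lg Pf Pg e e0; have e20 : 0 < e / 2 by rewrite divr_gt0.
  apply: filterS2 (Pf _ e20) (Pg _ e20) => s fs gs.
  rewrite (splitr e); apply: le_lt_trans (ltrD fs gs).
  have lf' := l1B (l1_ltransf s lf) lf; have lg' := l1B (l1_ltransf s lg) lg.
  apply: le_trans (nrm1D lf' lg'); rewrite le_eqVlt; apply/orP; left; apply/eqP.
  by congr nrm1; apply/funext => x /=; rewrite /ltransf/= opprD addrACA.
- move=> a f lf Pf e e0.
  have a0 : 0 < `|a| + 1 by rewrite ltr_wpDl.
  have ea0 : 0 < e / (`|a| + 1) by rewrite divr_gt0.
  apply: filterS (Pf _ ea0) => s fs.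
  rewrite (_ : ltransf s _ \- _ = fun x => a * (ltransf s f \- f) x); last first.
    by apply/funext => x /=; rewrite /ltransf mulrBr.
  rewrite nrm1Z; last exact: l1B (l1_ltransf s lf) lf.
  move: fs; rewrite ltr_pdivlMr// => fs; apply: le_lt_trans fs.
  by rewrite mulrC ler_wpM2l ?nrm1_ge0// lerDl.
- move=> f lf Hf e e0; have e30 : 0 < e / 3 by rewrite divr_gt0.
  have [g [lg Pg fg]] := Hf _ e30.
  apply: filterS (Pg _ e30) => s gs.
  have lfg := l1B lf lg; have lgs := l1B (l1_ltransf s lg) lg.
  have -> : ltransf s f \- f = ltransf s (f \- g) \+
    ((ltransf s g \- g) \+ (fun x => (-1) * (f \- g) x)).
    apply/funext => x /=; rewrite /ltransf/= mulN1r opprB.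
    by rewrite !subrKA.
  have l3 : l1 (fun x => -1 * (f \- g) x) by exact: l1Z.
  apply: le_lt_trans (nrm1D (l1_ltransf s lfg) (l1D lgs l3)) _.
  apply: le_lt_trans (lerD (lexx _) (nrm1D lgs l3)) _.
  rewrite nrm1Z// normrN normr1 mul1r nrm1_ltransf//.
  have -> : e = e / 3 + (e / 3 + e / 3).
    by rewrite -mulr2n -mulrS -[RHS]mulr_natr divfK.
  by rewrite ltrD// ltrD.
Qed.

Definition ess_bounded (phi : borel G -> R) (C : R) :=
  [/\ 0 <= C, measurable_fun setT phi & \forall x \ae haar, `|phi x| <= C].

(** This rests on [haar_invset_eq0]: inversion preserves null sets. *)
Lemma ae_reflect (P : borel G -> Prop) (y : G) : (\forall x \ae haar, P x) ->
  \forall x \ae haar, P ((x : G)^-1 * y)%g.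
Proof.
move=> [N [mN N0 NP]]; exists (ltrans y (invset N)); split.
- by apply: measurable_ltrans; exact: measurable_invset.
- rewrite (haar_ltrans H); last exact: measurable_invset.
  exact: (haar_invset_eq0 hG sG H).
- move=> x /= nP; rewrite ltransE /invset/= invgM invgK.
  exact: NP.
Qed.

Lemma essb_reflect phi C y : ess_bounded phi C ->
  ess_bounded (fun x => phi ((x : G)^-1 * y)%g) C.
Proof.
move=> [C0 mphi aephi]; split => //; last exact: (ae_reflect y aephi).
apply: (measurableT_comp mphi).
apply: (continuous_borel (f := fun x : G => (x^-1 * y)%g)) => x.
apply: (@continuous_comp _ _ _ (fun x : G => x^-1)%g (fun x : G => x * y)%g).
  exact: invg_continuous.
exact: mulgr_continuous.
Qed.

Lemma l1M_essb f phi C : l1 f -> ess_bounded phi C -> l1 (fun x => f x * phi x).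
Proof.
move=> lf [C0 mphi aephi]; have mf := l1_measurable lf.
have mfp : measurable_fun setT (fun x => (f x * phi x)%:E).
  by apply/measurable_EFinP; exact: measurable_funM.
apply/integrableP; split => //.
apply: (@le_lt_trans _ _ (\int[haar]_x (`|C|%:E * `|(f x)%:E|))%E); last first.
  rewrite ge0_integralZl//; last by apply/measurable_EFinP; exact: measurableT_comp.
  by rewrite lte_mul_pinfty//; have /integrableP[] := lf.
apply: ae_ge0_le_integral => //.
- exact: measurableT_comp.
- by apply: measurable_funeM; apply/measurable_EFinP; exact: measurableT_comp.
- move: aephi; apply: filterS => x px _ /=.
  rewrite lee_fin normrM mulrC ler_wpM2r//.
  by rewrite (le_trans px)// ler_norm.
Qed.

Lemma Rintegral_essb_le f phi C : l1 f -> ess_bounded phi C ->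
  `|\int[haar]_x (f x * phi x)| <= C * nrm1 f.
Proof.
move=> lf pC; have lfp := l1M_essb lf pC.
have lC : l1 (fun x => C * `|f x|) by apply: l1Z; exact: l1_norm.
apply: le_trans (Rintegral_le_nrm1 lfp) _.
rewrite /nrm1 -RintegralZl//; last exact: l1_norm.
rewrite -lee_fin /Rintegral !fineK; last 2 first.
- exact: (integrable_fin_num measurableT lC).
- exact: (integrable_fin_num measurableT (l1_norm lfp)).
have [C0 mphi aephi] := pC.
apply: ae_ge0_le_integral => //.
- by have /integrableP[] := l1_norm lfp.
- by move=> x _; rewrite lee_fin mulr_ge0.
- by have /integrableP[] := lC.
- apply: filterS aephi => x px _.
  by rewrite lee_fin normrM mulrC ler_wpM2r.
Qed.

Definition conv f phi : borel G -> R :=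
  fun y => \int[haar]_x (f x * phi ((x : G)^-1 * y)%g).

Lemma conv_le f phi C y : l1 f -> ess_bounded phi C -> `|conv f phi y| <= C * nrm1 f.
Proof. by move=> lf pC; apply: Rintegral_essb_le => //; exact: essb_reflect. Qed.

Lemma convDl f g phi C y : l1 f -> l1 g -> ess_bounded phi C ->
  conv (f \+ g) phi y = conv f phi y + conv g phi y.
Proof.
move=> lf lg pC; have pC' := essb_reflect y pC.
rewrite /conv -RintegralD//; [|exact: (l1M_essb lf pC')|exact: (l1M_essb lg pC')].
by apply: eq_Rintegral => x _ /=; rewrite mulrDl.
Qed.

Lemma convZl a f phi C y : l1 f -> ess_bounded phi C ->
  conv (fun x => a * f x) phi y = a * conv f phi y.
Proof.
move=> lf pC; have pC' := essb_reflect y pC.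
rewrite /conv -RintegralZl//; last exact: (l1M_essb lf pC').
by apply: eq_Rintegral => x _ /=; rewrite mulrA.
Qed.

Lemma convBl f g phi C y : l1 f -> l1 g -> ess_bounded phi C ->
  conv (f \- g) phi y = conv f phi y - conv g phi y.
Proof.
move=> lf lg pC; have lg' := l1Z (-1) lg.
rewrite -mulN1r -(convZl _ _ lg pC) -(convDl _ lf lg' pC).
by congr conv; apply/funext => x /=; rewrite mulN1r.
Qed.

Lemma convDr f phi psi C D y : l1 f -> ess_bounded phi C -> ess_bounded psi D ->
  conv f (phi \+ psi) y = conv f phi y + conv f psi y.
Proof.
move=> lf pC pD; have pC' := essb_reflect y pC; have pD' := essb_reflect y pD.
rewrite /conv -RintegralD//; [|exact: (l1M_essb lf pC')|exact: (l1M_essb lf pD')].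
by apply: eq_Rintegral => x _ /=; rewrite mulrDr.
Qed.

Lemma convZr f phi a C y : l1 f -> ess_bounded phi C ->
  conv f (fun x => a * phi x) y = a * conv f phi y.
Proof.
move=> lf pC; have pC' := essb_reflect y pC.
rewrite /conv -RintegralZl//; last exact: (l1M_essb lf pC').
by apply: eq_Rintegral => x _ /=; rewrite mulrCA.
Qed.

Lemma conv_ltransf f phi C s y : l1 f -> ess_bounded phi C ->
  conv (ltransf s f) phi y = conv f phi (s^-1 * y)%g.
Proof.
move=> lf pC; have pC' := essb_reflect (s^-1 * y)%g pC.
rewrite /conv -(Rintegral_ltransf s (l1M_essb lf pC')).
by apply: eq_Rintegral => x _; rewrite /ltransf invgM invgK -!mulgA mulVKg.
Qed.

Definition left_unif_continuous (F : G -> R) := forall e : R, 0 < e ->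
  \forall s \near (1%g : G), forall z, `|F (s * z)%g - F z| <= e.

Lemma luc_continuous F : left_unif_continuous F -> continuous F.
Proof.
move=> lF y; apply/cvgrPdist_le => e e0.
have c : (fun y' => y' * y^-1)%g z @[z --> y] --> (1%g : G).
  by rewrite -(mulgV y); exact: mulgr_continuous.
have Hn : \forall y' \near y, forall z, `|F (y' * y^-1 * z)%g - F z| <= e.
  exact: c _ (lF _ e0).
apply: filterS Hn => y' /(_ y).
by rewrite mulgVK distrC.
Qed.

Lemma near1_inv (P : G -> Prop) : (\forall s \near (1%g : G), P s) ->
  \forall s \near (1%g : G), P (s^-1)%g.
Proof.
move=> HP; have := @invg_continuous G 1%g P; rewrite invg1; exact.
Qed.

(** Translating [conv f phi] amounts to translating [f], which is continuous
    in L^1 by [ltransf_continuous]. *)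
Lemma conv_luc f phi C : l1 f -> ess_bounded phi C -> left_unif_continuous (conv f phi).
Proof.
move=> lf pC e e0; have [C0 _ _] := pC.
have eC : 0 < e / (C + 1) by rewrite divr_gt0// ltr_wpDl.
apply: filterS (near1_inv (ltransf_continuous lf eC)) => s fs z.
rewrite -{1}[s]invgK -(conv_ltransf _ _ lf pC) -(convBl _ (l1_ltransf _ lf) lf pC).
apply: le_trans (conv_le _ (l1B (l1_ltransf _ lf) lf) pC) _.
move: fs; rewrite ltr_pdivlMr ?ltr_wpDl// => /ltW; apply: le_trans.
by rewrite mulrC ler_wpM2l ?nrm1_ge0// lerDl.
Qed.

End Translation.

(** * Invariant functionals on integrable functions *)

Section InvariantFunctional.
Context {R : realType} {G : topGroupType}.
Hypotheses (hG : hausdorff_space G) (sG : sigma_compact [set: G]).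
Variable haar : {measure set (borel G) -> \bar R}.
Hypothesis H : left_haar haar.

Let mcpt (K : set G) (cK : compact K) : measurable (K : set (borel G)) :=
  borel_compact hG cK.

Local Notation l1 := (l1 haar).
Local Notation nrm1 := (nrm1 haar).
Implicit Types f g h : borel G -> R.

Section Positive.
Variables (Lam : (borel G -> R) -> R) (M : R).
Hypotheses (LD : forall f g, l1 f -> l1 g -> Lam (f \+ g) = Lam f + Lam g)
  (LM : forall f, l1 f -> `|Lam f| <= M * nrm1 f)
  (LI : forall s f, l1 f -> Lam (ltransf s f) = Lam f)
  (L0 : forall f, l1 f -> (forall x, 0 <= f x) -> 0 <= Lam f).
Variables (L : set G) (cL : compact L).

(** The measure that represents the positive functional [Lam] inside [L]. It
    is set to 0 off the Borel sets because a measure has to be nonnegative on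
    every set. *)
Definition functional_measure (E : set (borel G)) : \bar R :=
  if `[< measurable E >] then (Lam \1_(E `&` L))%:E else 0%E.

Let mL := mcpt cL.

Let functional_measureE (E : set (borel G)) : measurable E ->
  functional_measure E = (Lam \1_(E `&` L))%:E.
Proof. by move=> mE; rewrite /functional_measure asboolT. Qed.

Let l1L (E : set (borel G)) : measurable E -> l1 \1_(E `&` L).
Proof.
move=> mE; apply: l1_indic; first exact: measurableI.
apply: le_lt_trans (haar_compact H cL).
by apply: le_measure; rewrite ?inE//; exact: measurableI.
Qed.

Let functionalU (A B : set (borel G)) : measurable A -> measurable B ->
  A `&` B = set0 ->
  Lam \1_((A `|` B) `&` L) = Lam \1_(A `&` L) + Lam \1_(B `&` L).
Proof.
move=> mA mB AB; rewrite -LD; [|exact: l1L|exact: l1L].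
congr Lam; rewrite setIUl; apply/funext => x /=.
rewrite !indicE in_setU; have [xA|xA] := boolP (x \in A `&` L); last by rewrite add0r.
rewrite (_ : x \in B `&` L = false) ?addr0//; apply/negbTE/negP; move: xA.
rewrite !inE => -[Ax _] [Bx _].
by have : (A `&` B) x by []; rewrite AB.
Qed.

Let functional_set0 : Lam \1_(set0 `&` L) = 0.
Proof.
apply/eqP; rewrite -normr_le0; apply: le_trans (LM (l1L measurable0)) _.
by rewrite set0I nrm1_indic// measure0 mulr0.
Qed.

Let functional_measure0 : functional_measure set0 = 0%E.
Proof. by rewrite functional_measureE// functional_set0. Qed.

Let functional_measure_ge0 E : (0 <= functional_measure E)%E.
Proof.
rewrite /functional_measure; case: asboolP => // mE; rewrite lee_fin L0//; exact: l1L.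
Qed.

Let functional_measure_sigma_additive : semi_sigma_additive functional_measure.
Proof.
move=> F mF tF mUF.
pose U n := \big[setU/set0]_(i < n) F i.
have mU n : measurable (U n) by exact: bigsetU_measurable.
have UF n : U n `<=` \bigcup_n F n.
  by rewrite /U -bigcup_mkord; apply: bigcup_sub => i _; exact: bigcup_sup.
have sumE n : \sum_(0 <= i < n) functional_measure (F i) = (Lam \1_(U n `&` L))%:E.
  rewrite /U; elim: n => [|n IH].
    by rewrite big_geq// big_ord0 functional_set0.
  rewrite big_nat_recr//= IH big_ord_recr/= functionalU//;
    first by rewrite functional_measureE// EFinD.
    exact: bigsetU_measurable.
  rewrite -bigcup_mkord setI_bigcupl bigcup0// => i /= ni.
  by move/trivIsetP : tF => -> //; rewrite ltn_eqF.
have -> : (fun n => \sum_(0 <= i < n) functional_measure (F i))%E = EFin \o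
  (fun n => Lam \1_(U n `&` L)).
  by apply/funext => n; rewrite sumE.
rewrite functional_measureE//; apply: cvg_EFin; first by near=> n.
have UT : \bigcup_n U n = \bigcup_n F n.
  apply/seteqP; split; first by apply: bigcup_sub => n _; exact: UF.
  by move=> x [n _ Fx]; exists n.+1 => //; rewrite /U big_ord_recr/=; right.
set T := \bigcup_n F n in mUF UF UT *.
have hU : haar_on hG haar cL (U n) @[n --> \oo] --> haar_on hG haar cL T.
  rewrite -UT; apply: nondecreasing_cvg_mu => //; first by rewrite UT.
  by move=> m n mn; apply/subsetPset; exact: subset_bigsetU.
have hfin (X : set (borel G)) : measurable X -> haar_on hG haar cL X \is a fin_num.
  move=> mX; rewrite ge0_fin_numE//; apply: le_lt_trans (haar_on_fin hG H cL).
  by apply: le_measure; rewrite ?inE.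
apply/cvgrPdist_lt => e e0.
have M0 : 0 < `|M| + 1 by rewrite ltr_wpDl.
move: hU; rewrite -(fineK (hfin _ mUF)) =>
  /fine_cvgP[_ /cvgrPdist_lt /(_ _ (divr_gt0 e0 M0))].
apply: filterS => n /=; rewrite ltr_pdivlMr// => hn.
have mTU : measurable (T `\` U n) by exact: measurableD.
have -> : Lam \1_(T `&` L) = Lam \1_(U n `&` L) + Lam \1_((T `\` U n) `&` L).
  by rewrite -functionalU//; [rewrite setDUK|rewrite setDE setICA setICr setI0].
rewrite addrAC subrr add0r; apply: le_lt_trans (LM (l1L mTU)) _.
rewrite nrm1_indic; last exact: measurableI.
rewrite -[haar _](haar_onE hG haar cL) measureD//; last first.
  by rewrite -ge0_fin_numE// hfin.
rewrite setIidr// fineB//; [|exact: hfin|exact: hfin].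
apply: le_lt_trans hn; rewrite mulrC.
apply: le_trans (ler_norm _) _; rewrite normrM ler_wpM2l//.
by rewrite lerDl.
Unshelve. all: by end_near. Qed.

HB.instance Definition _ := isMeasure.Build _ _ _ functional_measure
  functional_measure0 functional_measure_ge0 functional_measure_sigma_additive.

Lemma functional_measure_compact (E : set G) : compact E -> E `<=` L ->
  functional_measure E = (Lam \1_(E : set (borel G)))%:E.
Proof. by move=> cE EL; rewrite functional_measureE ?setIidl//; exact: mcpt. Qed.

Lemma functional_proportional (A B B' : set G) : compact A -> compact B -> compact B' ->
  A `<=` L -> B `<=` L -> B' `<=` L -> (0 < haar A)%E ->
  (haar B' * (Lam \1_(B : set (borel G)))%:E = haar B *
    (Lam \1_(B' : set (borel G)))%:E)%E.
Proof.
move=> cA cB cB' AL BL B'L A0; rewrite -!functional_measure_compact//.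
apply: (left_invariant_proportional hG sG H cL (nu := functional_measure)) cA cB cB' AL
  BL B'L A0.
- by rewrite /= functional_measureE// ltry.
- move=> E mE EL0; rewrite /= functional_measureE//; congr EFin.
  apply/eqP; rewrite -normr_le0; apply: le_trans (LM (l1L mE)) _.
  by rewrite nrm1_indic ?EL0 ?mulr0//; exact: measurableI.
- rewrite /locally_invariant => t E cE EL tEL.
  have ctE : compact (ltrans t E) by exact: compact_ltrans.
  rewrite [LHS]functional_measure_compact// [RHS]functional_measure_compact//
    -ltransf_indic LI//.
  by apply: l1_indic; [exact: mcpt|exact: (haar_compact H)].
Qed.

End Positive.

(** Adding [M] times the integral makes the functional positive, so that it
    is given on the compact sets by a locally invariant measure and
    [left_invariant_proportional] applies there. Indicators of compact sets
    suffice by [l1_ind]. *)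
Lemma invariant_functional (Lam : (borel G -> R) -> R) (M : R) :
  (forall f g, l1 f -> l1 g -> Lam (f \+ g) = Lam f + Lam g) ->
  (forall a f, l1 f -> Lam (fun x => a * f x) = a * Lam f) ->
  (forall f, l1 f -> `|Lam f| <= M * nrm1 f) ->
  (forall s f, l1 f -> Lam (ltransf s f) = Lam f) ->
  exists c, forall f, l1 f -> Lam f = c * \int[haar]_x f x.
Proof.
move=> LD LZ LM LI.
(* positive because [- Lam f <= M * nrm1 f] *)
pose Lam' f := Lam f + M * \int[haar]_x f x.
have LD' f g : l1 f -> l1 g -> Lam' (f \+ g) = Lam' f + Lam' g.
  move=> lf lg; rewrite /Lam' LD// RintegralD// mulrDr addrACA//.
have LM' f : l1 f -> `|Lam' f| <= (M + `|M|) * nrm1 f.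
  move=> lf; rewrite mulrDl; apply: le_trans (ler_normD _ _) _.
  apply: lerD; first exact: LM.
  by rewrite normrM ler_wpM2l//; exact: Rintegral_le_nrm1.
have LI' s f : l1 f -> Lam' (ltransf s f) = Lam' f.
  by move=> lf; rewrite /Lam' LI// Rintegral_ltransf.
have L0' f : l1 f -> (forall x, 0 <= f x) -> 0 <= Lam' f.
  move=> lf f0; rewrite /Lam' addrC -lerBlDr sub0r.
  have -> : \int[haar]_x f x = nrm1 f.
    by apply: eq_Rintegral => x _; rewrite ger0_norm.
  by apply: le_trans (LM _ lf); rewrite -normrN ler_norm.
have [B [cB B0]] := haar_compact_gt0 hG H.
have Bf := haar_fin_num H cB; have mB := mcpt cB.
have fB0 : 0 < fine (haar B) by rewrite fine_gt0// B0/= -ge0_fin_numE.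
pose c' := Lam' \1_(B : set (borel G)) / fine (haar B).
exists (c' - M).
have bound f : l1 f -> `|Lam f - (c' - M) * \int[haar]_x f x| <= (M + `|c' - M|) * nrm1
  f.
  move=> lf; rewrite [leRHS]mulrDl; apply: le_trans (ler_normB _ _) _.
  apply: lerD; first exact: LM.
  by rewrite normrM ler_wpM2l//; exact: Rintegral_le_nrm1.
pose P f := Lam f = (c' - M) * \int[haar]_x f x.
apply: (@l1_ind _ _ hG sG _ H P); rewrite /P.
- move=> E cE; have Ef := haar_fin_num H cE.
  have cL : compact (B `|` E) by exact: compactU.
  have := functional_proportional LD' LM' LI' L0' cL cB cE cB (@subsetUl _ _ _)
    (@subsetUr _ _ _) (@subsetUl _ _ _) B0.
  rewrite -(fineK Bf) -(fineK Ef) -!EFinM => -[E1].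
  rewrite Rintegral_indicT; last exact: mcpt.
  have : Lam' \1_(E : set (borel G)) = c' * fine (haar E).
    by rewrite /c' mulrAC [_ * fine (haar E)]mulrC -E1 mulrAC divff ?mul1r// gt_eqF.
  rewrite {1}/Lam' Rintegral_indicT; last exact: mcpt.
  by rewrite mulrBl => <-; rewrite addrK.
- move=> f g lf lg Pf Pg; rewrite LD// RintegralD// Pf Pg mulrDr//.
- move=> a f lf Pf; rewrite LZ// Pf RintegralZl// mulrCA//.
- move=> f lf Hf; apply/eqP; rewrite -subr_eq0 -normr_le0.
  apply/ler_addgt0Pr => e e0; rewrite add0r.
  pose D := `|M + `|c' - M| |; have D0 : 0 < D + 1.
    by apply: ltr_wpDl => //; exact: normr_ge0.
  have [g [lg Pg fg]] := Hf _ (divr_gt0 e0 D0).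
  have -> : Lam f - (c' - M) * \int[haar]_x f x =
      Lam (f \- g) - (c' - M) * \int[haar]_x (f \- g) x.
    have lg' := l1Z (-1) lg; have lfg := l1B lf lg.
    have {1 2}-> : f = (f \- g) \+ g by apply/funext => x /=; rewrite subrK.
    rewrite LD// RintegralD// Pg mulrDr opprD addrACA subrr addr0//.
  apply: le_trans (bound _ (l1B lf lg)) _.
  apply: le_trans (_ : (D + 1) * nrm1 (f \- g) <= _); last first.
    by move: fg; rewrite ltr_pdivlMr// mulrC => /ltW.
  by rewrite ler_wpM2r ?nrm1_ge0// (le_trans (ler_norm _))// lerDl.
Qed.

End InvariantFunctional.

(** * Means on essentially bounded functions *)

Section LinftyInterface.
Context {R : realType} {G : topGroupType}.
Variable haar : {measure set (borel G) -> \bar R}.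
Hypothesis haar0 : (0 < haar setT)%E.

Local Notation ess_bounded := (ess_bounded haar).
Local Notation Linf := (@Linfty R G haar).

(** The conversion that occurs in [chi], [ltransl] and [convol]; [toLE]
    evaluates all of them. *)
Definition toL (F : borel G -> R) : Linf := insubd (0 : Linf) F.

Lemma Linfty_essb (phi : Linf) : exists C, ess_bounded phi C.
Proof.
have := Lfunction_finite _ phi; rewrite /finite_norm unlock haar0 => Noo.
have Nge0 : (0 <= ess_sup haar (abse \o (EFin \o phi)))%E.
  by apply: ess_sup_ger => // x; rewrite abse_ge0.
exists (fine (ess_sup haar (abse \o (EFin \o phi)))); split.
- exact: fine_ge0.
- exact: (measurable_funPT phi).
have := ess_sup_ge haar (abse \o (EFin \o phi)); apply: filterS => x /= gx.
by rewrite -lee_fin fineK// ge0_fin_numE.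
Qed.

Lemma norm_essb (phi : borel G -> R) C : ess_bounded phi C ->
  ('N[haar]_+oo[EFin \o phi] <= C%:E)%E.
Proof.
move=> [C0 mphi aephi]; rewrite unlock haar0; apply/ess_supP.
by apply: filterS aephi => x px; rewrite /= lee_fin.
Qed.

Lemma toLE (F : borel G -> R) C : ess_bounded F C -> toL F = F :> (borel G -> R).
Proof.
move=> FC; have [C0 mF _] := FC; rewrite /toL.
have FL : F \in @Lfun _ _ R haar +oo%E.
  apply/andP; split; rewrite inE//= /finite_norm.
  by apply: le_lt_trans (norm_essb FC) _; exact: ltry.
by rewrite insubdK.
Qed.

Lemma Linf_eq (phi psi : Linf) : phi =1 psi -> phi = psi.
Proof. by move=> h; apply/val_inj/funext. Qed.

Lemma essbD F E C D : ess_bounded F C -> ess_bounded E D ->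
  ess_bounded (F \+ E) (C + D).
Proof.
move=> [C0 mF aF] [D0 mE aE]; split; [exact: addr_ge0|exact: measurable_funD|].
apply: filterS2 aF aE => x Fx Ex /=.
by apply: le_trans (ler_normD _ _) _; exact: lerD.
Qed.

Lemma essbZ F C a : ess_bounded F C -> ess_bounded (fun x => a * F x) (`|a| * C).
Proof.
move=> [C0 mF aF]; split; [by rewrite mulr_ge0|exact: measurable_funM|].
by apply: filterS aF => x Fx; rewrite normrM ler_wpM2l.
Qed.

Lemma essb_cst a : ess_bounded (cst a) `|a|.
Proof. by split => //; apply: aeW. Qed.

Lemma toLD F E C D : ess_bounded F C -> ess_bounded E D -> toL (F \+ E) = toL F + toL E.
Proof.
move=> FC ED; apply: Linf_eq => x.
by rewrite (toLE (essbD FC ED)) /= (toLE FC) (toLE ED).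
Qed.

Lemma toLZ F C a : ess_bounded F C -> toL (fun x => a * F x) = a *: toL F.
Proof.
move=> FC; apply: Linf_eq => x.
by rewrite (toLE (essbZ a FC)) /= (toLE FC).
Qed.

Section Mean.
Variable m : {scalar Linf}.

Lemma positive_le (phi : Linf) (c : R) :
  (forall psi : Linf, (\forall x \ae haar, 0 <= psi x) -> 0 <= m psi) ->
  (\forall x \ae haar, `|phi x| <= c) -> `|m phi| <= c * m (toL (cst 1)).
Proof.
move=> mpos phic.
have e1 x : toL (cst 1) x = 1 by rewrite (toLE (essb_cst 1)).
have <- : m (c *: toL (cst 1)) = c * m (toL (cst 1)) by rewrite linearZ.
rewrite ler_norml; apply/andP; split.
  rewrite -subr_ge0 opprK -linearD; apply: mpos.
  apply: filterS phic => x; rewrite ler_norml => /andP[px _].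
  change (0 <= phi x + c * toL (cst 1) x).
  by rewrite e1 mulr1 -lerBlDr sub0r.
rewrite -subr_ge0 -linearB; apply: mpos.
apply: filterS phic => x; rewrite ler_norml => /andP[_ px].
change (0 <= c * toL (cst 1) x - phi x).
by rewrite e1 mulr1 subr_ge0.
Qed.

Let norm_one : ('N[haar]_+oo[EFin \o toL (cst 1%R)] <= 1)%E.
Proof.
rewrite (toLE (essb_cst 1)); apply: le_trans (norm_essb (essb_cst 1)) _.
by rewrite normr1.
Qed.

Let norm_le1 (phi : Linf) : ('N[haar]_+oo[EFin \o phi] <= 1)%E ->
  \forall x \ae haar, `|phi x| <= 1.
Proof.
rewrite unlock haar0 => /ess_supP.
by apply: filterS => x; rewrite /= lee_fin.
Qed.

(** A positive functional satisfies |m phi| <= m 1 as soon as |phi| <= 1, so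
    its norm is its value at 1. *)
Lemma mean_of_positive :
  (forall phi : Linf, (\forall x \ae haar, 0 <= phi x) -> 0 <= m phi) ->
  m (toL (cst 1)) = 1 -> means haar m.
Proof.
move=> mpos m1; split => //; apply/eqP; rewrite eq_le; apply/andP; split.
  apply: ub_ereal_sup => _ [phi /= phi1 <-]; rewrite lee_fin.
  by apply: le_trans (positive_le mpos (norm_le1 phi1)) _; rewrite m1 mulr1.
apply: ereal_sup_ubound; exists (toL (cst 1)); last by rewrite m1 normr1.
exact: norm_one.
Qed.

Hypothesis mm : means haar m.

Lemma mean1 : m (toL (cst 1)) = 1.
Proof.
have [dn mpos] := mm.
have e1 : toL (cst 1) = cst 1 :> (borel G -> R) by exact: toLE (essb_cst 1).
have m0 : 0 <= m (toL (cst 1)) by apply: mpos; apply: aeW => x; rewrite e1 /=.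
have dn1 : (dual_norm m <= 1)%E by rewrite dn.
have dn2 : (1 <= dual_norm m)%E by rewrite dn.
apply/eqP; rewrite eq_le; apply/andP; split.
  rewrite -lee_fin; apply: le_trans dn1; apply: ereal_sup_ubound.
  by exists (toL (cst 1)); [exact: norm_one|rewrite ger0_norm].
rewrite -lee_fin; apply: (le_trans dn2); apply: ub_ereal_sup => _ [phi /= phi1 <-];
  rewrite lee_fin.
by apply: le_trans (positive_le mpos (norm_le1 phi1)) _; rewrite mul1r.
Qed.

Lemma mean_le (F : borel G -> R) (C c : R) : ess_bounded F C ->
  (\forall x \ae haar, `|F x| <= c) ->
  `|m (toL F)| <= c.
Proof.
have [_ mpos] := mm => FC Fc.
have := @positive_le (toL F) c mpos; rewrite mean1 mulr1; apply.
by apply: filterS Fc => x; rewrite (toLE FC).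
Qed.

End Mean.
End LinftyInterface.

Section Ultralimit.
Context {R : realType}.

(** The interval [[- M, M]] is compact. *)
Lemma ultra_cvg_bounded (w : set_system nat) (u : nat -> R) (M : R) : UltraFilter w ->
  (forall n, `|u n| <= M) -> cvg (u @ w).
Proof.
move=> uw uM.
have cI : compact `[(- M), M]%classic by exact: segment_compact.
have [l [_ cl]] : `[(- M), M]%classic `&` cluster (u @ w) !=set0.
  apply: cI; apply: (@filterS _ w _ setT); last exact: filterT.
  by move=> n _ /=; rewrite in_itv/= -ler_norml.
apply/cvg_ex; exists l => A Al.
have [//|nA] := in_ultra_setVsetC (u @^-1` A) uw.
have [z [nAz Az]] := cl (~` A) A nA Al.
by [].
Qed.

End Ultralimit.

(** * Topologically invariant means carried by thick sets *)

Section ThickMean.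
Context {R : realType} {G : topGroupType}.
Hypotheses (hG : hausdorff_space G) (sG : sigma_compact [set: G]).
Variable haar : {measure set (borel G) -> \bar R}.
Hypothesis H : left_haar haar.
Local Notation ess_bounded := (ess_bounded haar).
Local Notation Linf := (@Linfty R G haar).
Local Notation l1 := (l1 haar).
Local Notation nrm1 := (nrm1 haar).
Local Notation toL := (toL haar).
Local Notation conv := (conv haar).

Let mcpt (K : set G) (cK : compact K) : measurable (K : set (borel G)) :=
  borel_compact hG cK.

Let haar0 : (0 < haar setT)%E.
Proof. by rewrite measure_gt0; exact: (haar_neq0 H). Qed.

Variables (w : set_system nat) (x : nat -> G).
Hypotheses (uw : UltraFilter w) (woo : \oo `<=` w).

Definition bounded_by (F : G -> R) (M : R) := forall y, `|F y| <= M.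

(** The behaviour of [F] along the right translations by [x n], seen from
    every [y]. *)
Definition shiftlim (F : G -> R) : G -> R := fun y =>
  lim ((fun n => F (y * x n)%g) @ w).

Lemma shiftlim_cvg F M y : bounded_by F M ->
  (fun n => F (y * x n)%g) @ w --> shiftlim F y.
Proof. by move=> FM; apply: (@ultra_cvg_bounded _ w _ M) => // n; exact: FM. Qed.

Lemma shiftlim_eq F y l : (fun n => F (y * x n)%g) @ \oo --> l -> shiftlim F y = l.
Proof.
move=> Fl; apply: cvg_lim => //; apply: cvg_trans Fl => A /= HA.
exact: woo.
Qed.

Lemma shiftlimD F E M N : bounded_by F M -> bounded_by E N ->
  shiftlim (F \+ E) = shiftlim F \+ shiftlim E.
Proof.
move=> FM EN; apply/funext => y; apply: cvg_lim => //.
have := cvgD (@shiftlim_cvg _ _ y FM) (@shiftlim_cvg _ _ y EN); exact.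
Qed.

Lemma shiftlimZ a F M : bounded_by F M ->
  shiftlim (fun y => a * F y) = fun y => a * shiftlim F y.
Proof.
move=> FM; apply/funext => y; apply: cvg_lim => //.
have := cvgM (cvg_cst a) (@shiftlim_cvg _ _ y FM); exact.
Qed.

Lemma shiftlim_dist F E M N y e : bounded_by F M -> bounded_by E N ->
  (forall n, `|F (y * x n)%g - E (y * x n)%g| <= e) ->
    `|shiftlim F y - shiftlim E y| <= e.
Proof.
move=> FM EN FE.
have h : (fun n => `|F (y * x n)%g - E (y * x n)%g|) @ w --> `|shiftlim F y - shiftlim
  E y|.
  exact: cvg_norm (cvgB (@shiftlim_cvg _ _ y FM) (@shiftlim_cvg _ _ y EN)).
rewrite -(cvg_lim _ h)//; apply: limr_le; first exact: cvgP h.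
by apply: nearW.
Qed.

Lemma shiftlim_ge0 F M y : bounded_by F M -> (forall z, 0 <= F z) -> 0 <= shiftlim F y.
Proof.
move=> FM F0; apply: limr_ge; first exact: cvgP (@shiftlim_cvg _ _ y FM).
by apply: nearW.
Qed.

Lemma shiftlim_bounded F M : bounded_by F M -> bounded_by (shiftlim F) M.
Proof.
move=> FM y.
have h : (fun n => `|F (y * x n)%g|) @ w --> `|shiftlim F y|.
  exact: cvg_norm (@shiftlim_cvg _ _ y FM).
rewrite -(cvg_lim _ h)//; apply: limr_le; first exact: cvgP h.
by apply: nearW => n; exact: FM.
Qed.

Lemma shiftlim_luc F M : bounded_by F M -> left_unif_continuous F ->
  left_unif_continuous (shiftlim F).
Proof.
move=> FM lF e e0; apply: filterS (lF _ e0) => s Fs y.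
have FsM : bounded_by (fun y => F (s * y)%g) M by move=> z; exact: FM.
have -> : shiftlim F (s * y)%g = shiftlim (fun y => F (s * y)%g) y.
  by rewrite /shiftlim; under eq_fun do rewrite -mulgA.
by apply: (shiftlim_dist FsM FM) => n; exact: Fs.
Qed.

Lemma luc_essb (F : G -> R) M : bounded_by F M -> left_unif_continuous F ->
  ess_bounded F M.
Proof.
move=> FM lF; split.
- exact: le_trans (FM 1%g).
- by apply: continuous_borel_real; exact: luc_continuous.
- by apply: aeW => y; exact: FM.
Qed.

Lemma conv_bounded f phi C : l1 f -> ess_bounded phi C ->
  bounded_by (conv f phi) (C * nrm1 f).
Proof. by move=> lf pC y; exact: (conv_le hG sG H). Qed.

Lemma shiftconv_essb f phi C : l1 f -> ess_bounded phi C ->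
  ess_bounded (shiftlim (conv f phi)) (C * nrm1 f).
Proof.
move=> lf pC; have b := conv_bounded lf pC.
by apply: luc_essb; [exact: shiftlim_bounded|apply: (shiftlim_luc b);
  exact: (conv_luc hG sG H lf pC)].
Qed.

Variable m : {scalar Linf}.
Hypotheses (mm : means haar m)
  (mi : forall (s : G) (phi : Linf), m phi = m (ltransl s phi)).

(** A functional of two variables: as a functional of [phi] it will be a
    topologically invariant mean, as a functional of [f] it is bounded and left
    invariant. *)
Definition shift_mean (phi f : borel G -> R) : R := m (toL (shiftlim (conv f phi))).

Lemma shift_meanD phi C f g : ess_bounded phi C -> l1 f -> l1 g ->
  shift_mean phi (f \+ g) = shift_mean phi f + shift_mean phi g.
Proof.
move=> pC lf lg; rewrite /shift_mean.
have -> : conv (f \+ g) phi = conv f phi \+ conv g phi.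
  by apply/funext => y; rewrite (convDl hG sG H _ lf lg pC).
rewrite (shiftlimD (conv_bounded lf pC) (conv_bounded lg pC)).
by rewrite (toLD haar0 (shiftconv_essb lf pC) (shiftconv_essb lg pC)) linearD.
Qed.

Lemma shift_meanZ phi C a f : ess_bounded phi C -> l1 f ->
  shift_mean phi (fun y => a * f y) = a * shift_mean phi f.
Proof.
move=> pC lf; rewrite /shift_mean.
have -> : conv (fun y => a * f y) phi = fun y => a * conv f phi y.
  by apply/funext => y; rewrite (convZl hG sG H _ _ lf pC).
rewrite (shiftlimZ a (conv_bounded lf pC)).
by rewrite (toLZ haar0 a (shiftconv_essb lf pC)) linearZ.
Qed.

Lemma shift_mean_le phi C f : ess_bounded phi C -> l1 f ->
  `|shift_mean phi f| <= C * nrm1 f.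
Proof.
move=> pC lf; have [_ _ Hae] := shiftconv_essb lf pC.
exact: (mean_le haar0 mm (shiftconv_essb lf pC)).
Qed.

(** Translating [f] on the left translates [conv f phi] on the left; this
    commutes with the right translations in [shiftlim] and is absorbed by
    [m]. *)
Lemma shift_mean_ltransf phi C s f : ess_bounded phi C -> l1 f ->
  shift_mean phi (ltransf s f) = shift_mean phi f.
Proof.
move=> pC lf; rewrite /shift_mean [RHS](mi s); congr (m _).
have e1 := shiftconv_essb (l1_ltransf H s lf) pC.
have e2 := shiftconv_essb lf pC.
have E : shiftlim (conv (ltransf s f) phi) = fun y =>
  shiftlim (conv f phi) (s^-1 * y)%g.
  apply/funext => y; rewrite /shiftlim;
    under eq_fun do rewrite (conv_ltransf hG sG H s _ lf pC) mulgA.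
  by [].
apply: val_inj; rewrite /= /ltransl.
rewrite (toLE haar0 e2) -E.
by [].
Qed.

(** Topological invariance originates here: the value depends on [f] only
    through its integral. *)
Lemma shift_mean_const phi C : ess_bounded phi C ->
  exists c, forall f, l1 f -> shift_mean phi f = c * \int[haar]_y f y.
Proof.
move=> pC; apply: (invariant_functional hG sG H (M := C)).
- by move=> f g lf lg; exact: shift_meanD pC lf lg.
- by move=> a f lf; exact: shift_meanZ pC lf.
- by move=> f lf; exact: shift_mean_le.
- by move=> s f lf; exact: shift_mean_ltransf pC lf.
Qed.

Definition uniform_density (B : set G) : borel G -> R :=
  fun z => (fine (haar B))^-1 * (\1_(B : set (borel G)) : borel G -> R) z.

Section Unif.
Variables (B : set G).
Hypotheses (cB : compact B) (B0 : (0 < haar B)%E).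

Let fB0 : 0 < fine (haar B).
Proof. by rewrite fine_gt0// B0/= -ge0_fin_numE//; exact: (haar_fin_num H). Qed.

Let l1B : l1 \1_(B : set (borel G)).
Proof. by apply: l1_indic; [exact: mcpt|exact: (haar_compact H)]. Qed.

Lemma l1_unif : l1 (uniform_density B).
Proof. exact: l1Z. Qed.

Lemma Rintegral_unif : \int[haar]_z uniform_density B z = 1.
Proof.
rewrite /uniform_density RintegralZl// Rintegral_indicT; last exact: mcpt.
by rewrite mulVf// gt_eqF.
Qed.

Lemma unif_ge0 z : 0 <= uniform_density B z.
Proof. by rewrite /uniform_density mulr_ge0// invr_ge0 ltW. Qed.

End Unif.

Lemma scalar_pack (V : lmodType R) (f : V -> R) : scalar f ->
  exists m' : {scalar V}, (m' : V -> R) = f.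
Proof.
move=> sf; pose M := GRing.isLinear.Build R V R *%R f sf.
pose fl : {scalar V} := HB.pack f M.
by exists fl.
Qed.

Lemma shift_mean_scalar f : l1 f -> scalar (fun phi : Linf => shift_mean phi f).
Proof.
move=> lf a phi psi.
have [C pC] := Linfty_essb haar0 phi; have [D pD] := Linfty_essb haar0 psi.
rewrite /shift_mean.
have -> : conv f (a *: phi + psi) = (fun y => a * conv f phi y) \+ conv f psi.
  apply/funext => y /=.
  rewrite -(convZr hG sG H a y lf pC) -(convDr hG sG H y lf (essbZ a pC) pD).
  by [].
have b1 := conv_bounded lf pC; have b2 := conv_bounded lf pD.
have b3 : bounded_by (fun y => a * conv f phi y) (`|a| * (C * nrm1 f)).
  by move=> y; rewrite normrM ler_wpM2l.
rewrite (shiftlimD b3 b2) (shiftlimZ a b1).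
have s1 := shiftconv_essb lf pC; have s2 := shiftconv_essb lf pD.
by rewrite (toLD haar0 (essbZ a s1) s2) (toLZ haar0 a s1) linearD linearZ.
Qed.

Lemma conv_ge0 f (phi : Linf) y : l1 f -> (forall z, 0 <= f z) ->
  (\forall z \ae haar, 0 <= phi z) -> 0 <= conv f phi y.
Proof.
move=> lf f0 p0; have [C pC] := Linfty_essb haar0 phi.
have pC' := essb_reflect hG sG H y pC.
have lfp := l1M_essb lf pC'.
rewrite /conv; have -> : \int[haar]_z (f z * phi ((z : G)^-1 * y)%g) =
    \int[haar]_z `|f z * phi ((z : G)^-1 * y)%g|.
  rewrite /Rintegral; congr fine; apply: ae_eq_integral => //.
  - by have /integrableP[] := lfp.
  - by have /integrableP[] := l1_norm lfp.
  - have [N [mN N0 NP]] := ae_reflect hG sG H y p0.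
    exists N; split => // z nz; apply: NP => /= pz; apply: nz => _.
    by rewrite ger0_norm// mulr_ge0.
exact: Rintegral_ge0.
Qed.

Lemma shift_mean_ge0 f (phi : Linf) : l1 f -> (forall z, 0 <= f z) ->
  (\forall z \ae haar, 0 <= phi z) -> 0 <= shift_mean phi f.
Proof.
move=> lf f0 p0; have [C pC] := Linfty_essb haar0 phi.
have [_ mpos] := mm; apply: mpos; apply: aeW => y.
rewrite (toLE haar0 (shiftconv_essb lf pC)).
by apply: (shiftlim_ge0 _ (conv_bounded lf pC)) => z; exact: conv_ge0.
Qed.

Lemma shift_mean_eq1 (phi f : borel G -> R) C : l1 f -> ess_bounded phi C ->
  (forall y, (fun n => conv f phi (y * x n)%g) @ \oo --> (1 : R)) ->
    shift_mean phi f = 1.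
Proof.
move=> lf pC h; apply: etrans (mean1 haar0 mm); congr (m (toL _)).
by apply/funext => y; exact: shiftlim_eq.
Qed.

Lemma conv_cst1 f y : conv f (cst 1) y = \int[haar]_z f z.
Proof. by apply: eq_Rintegral => z _; rewrite mulr1. Qed.

(** By [shift_mean_const] the set [B] may be replaced by a small neighbourhood [V]
    of 1. As [conv f phi] is left uniformly continuous, its averages over [V]
    are uniformly close to it. *)
Lemma shift_mean_absorb (phi f : borel G -> R) C (B : set G) :
  l1 f -> ess_bounded phi C -> compact B -> (0 < haar B)%E ->
  shift_mean (conv f phi) (uniform_density B) = shift_mean phi f.
Proof.
move=> lf pC cB B0.
have b := conv_bounded lf pC; have lc := conv_luc hG sG H lf pC.
have eb := luc_essb b lc.
have [c lamc] := shift_mean_const eb.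
apply/eqP; rewrite -subr_eq0 -normr_le0; apply/ler_addgt0Pr => e e0; rewrite add0r.
(* [V] consists of [s] with [s^-1] in the neighbourhood given by uniform
   continuity, because the convolution evaluates at [s^-1 z] *)
have [V [cV VW V0]] := compact_nbhs1 hG H (near1_inv (lc _ e0)).
have lB := l1_unif cB; have lV := l1_unif cV.
have -> : shift_mean (conv f phi) (uniform_density B) = shift_mean (conv f phi)
  (uniform_density V).
  by rewrite !lamc// !Rintegral_unif.
rewrite /shift_mean.
have s1 := shiftconv_essb lV eb; have s2 := shiftconv_essb lf pC.
have -> : m (toL (shiftlim (conv (uniform_density V) (conv f phi)))) -
    m (toL (shiftlim (conv f phi))) =
    m (toL (shiftlim (conv (uniform_density V) (conv f phi)) \+
      (fun y => -1 * shiftlim (conv f phi) y))).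
  by rewrite (toLD haar0 s1 (essbZ (-1) s2)) (toLZ haar0 (-1) s2) scaleN1r linearB.
apply: (mean_le haar0 mm (essbD s1 (essbZ (-1) s2))).
apply: aeW => y /=; rewrite mulN1r.
apply: (shiftlim_dist (conv_bounded lV eb) b) => n.
set z := (y * x n)%g.
have eb' := essb_reflect hG sG H z eb.
set psi := conv f phi in eb eb' lc b *; set c0 := psi z.
have l2 := l1B (l1M_essb lV eb') (l1Z c0 lV).
have E s : (fun s => uniform_density V s * psi ((s : G)^-1 * z)%g) s - c0 *
  uniform_density V s =
    uniform_density V s * (psi ((s : G)^-1 * z)%g - c0).
  by rewrite mulrBr [c0 * _]mulrC.
have -> : conv (uniform_density V) psi z - c0 =
    \int[haar]_s (uniform_density V s * psi ((s : G)^-1 * z)%g - c0 * uniform_density V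
      s).
  rewrite RintegralB//; [|exact: (l1M_essb lV eb')|exact: l1Z].
  by rewrite RintegralZl// Rintegral_unif// mulr1.
apply: le_trans (Rintegral_le_nrm1 l2) _.
rewrite -[e]mulr1 -(Rintegral_unif cV V0) -RintegralZl//.
apply: le_Rintegral => //; [exact: l1_norm|exact: l1Z|].
move=> s _ /=; rewrite E normrM ger0_norm ?unif_ge0// mulrC.
rewrite /uniform_density indicE; have [sV|] := boolP (s \in (V : set (borel G)));
  last by rewrite !mulr0.
rewrite ler_wpM2r ?mulr1 ?invr_ge0 ?fine_ge0//.
by apply: VW; rewrite inE in sV.
Qed.

(** At [y * x n] the convolution is the proportion of the [z] in [B] such that
    [z^-1 * y * x n] is in [E], which is the case as soon as [z^-1 * y] is in
    [K n]. *)
Lemma conv_unif_indic_cvg (B : set G) (E : set (borel G)) (K : nat -> set G) (y : G) :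
  compact B -> (0 < haar B)%E -> measurable E ->
  (forall n, measurable (K n : set (borel G))) -> nondecreasing_seq K ->
  \bigcup_n K n = setT -> (forall n, rtrans (K n) (x n) `<=` E) ->
  (fun n => conv (uniform_density B) \1_E (y * x n)%g) @ \oo --> (1 : R).
Proof.
move=> cB B0 mE mK ndK KT KE.
have Bf := haar_fin_num H cB; have mB := mcpt cB; have lB := l1_unif cB.
have fB0 : 0 < fine (haar B) by rewrite fine_gt0// B0/= -ge0_fin_numE.
(* The proportion of [S n] in [B] bounds the convolution from below, the
   integral of the density bounds it from above. *)
pose S n : set (borel G) := [set z : G | K n (z^-1 * y)%g].
have mS n : measurable (S n).
  rewrite -[S n]setTI.
  apply: (continuous_borel (f := fun z : G => (z^-1 * y)%g)) => //.
  move=> z; apply: (@continuous_comp _ _ _ (fun z : G => z^-1)%g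
    (fun z : G => z * y)%g).
    exact: invg_continuous.
  exact: mulgr_continuous.
have mBS n : measurable (B `&` S n : set (borel G)) by exact: measurableI.
have BST : \bigcup_n (B `&` S n) = B.
  rewrite -setI_bigcupr (_ : \bigcup_n S n = setT) ?setIT//.
  apply/seteqP; split => // z _; have : [set: G] (z^-1 * y)%g by [].
  by rewrite -KT => -[n _ Kn]; exists n.
have BSB n : (haar (B `&` S n) <= haar B)%E by apply: measureIl.
have BSf n : haar (B `&` S n) \is a fin_num.
  by rewrite ge0_fin_numE//; apply: le_lt_trans (BSB n) _; rewrite -ge0_fin_numE.
have cv : haar (B `&` S n) @[n --> \oo] --> haar B.
  rewrite -[in X in _ --> X]BST; apply: nondecreasing_cvg_mu => //.
    by rewrite BST.
  move=> i j ij; apply/subsetPset; apply: setIS => z; rewrite /S/=.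
  by move/subsetPset: (ndK _ _ ij); exact.
have eE : ess_bounded \1_E 1.
  split => //; apply: aeW => z; rewrite indicE.
  by case: (z \in E); rewrite ?normr1 ?normr0.
have cv2 : (fun n => (fine (haar B))^-1 * fine (haar (B `&` S n))) @ \oo --> (1 : R).
  rewrite -[X in _ --> X](mulVf (lt0r_neq0 fB0)); apply: cvgM; first exact: cvg_cst.
  by move: cv; rewrite -{1}(fineK Bf) => /fine_cvgP[].
apply: (@squeeze_cvgr _ _ _ _ (fun n => (fine (haar B))^-1 * fine (haar (B `&` S n)))
  (fun=> (1 : R))) cv2 (cvg_cst (1 : R)); apply: nearW => n /=.
have eE' := essb_reflect hG sG H (y * x n)%g eE.
have lBE := l1M_essb lB eE'.
have lBS : l1 (\1_(B `&` S n : set (borel G))) by apply: l1_indic => //;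
  rewrite -ge0_fin_numE.
apply/andP; split.
  rewrite -(Rintegral_indicT haar (mBS n)) -RintegralZl//.
  apply: le_Rintegral => //; first exact: l1Z.
  move=> z _ /=; rewrite /uniform_density -mulrA ler_wpM2l ?invr_ge0 ?(ltW fB0)//.
  rewrite !indicE in_setI; have [zB|_] := boolP (z \in (B : set (borel G)));
    last by rewrite mul0r.
  rewrite mul1r /=; have [zS|_] := boolP (z \in S n); last by [].
  rewrite mem_set//; apply: (KE n); rewrite rtransE/= mulgA mulgK.
  by rewrite inE in zS.
rewrite -(Rintegral_unif cB B0); apply: le_Rintegral => //.
move=> z _ /=; rewrite -[leRHS]mulr1 ler_wpM2l ?unif_ge0//.
Qed.

(** The mean is [phi |-> shift_mean phi (uniform_density B)]. It takes [conv f phi] to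
    [shift_mean phi f] by [shift_mean_absorb], and this is the value at [phi]
    because [f] and [uniform_density B] have the same integral. Its value at the
    indicator of [E] is 1 by [conv_unif_indic_cvg]. *)
Lemma thick_TLIM (E : set (borel G)) (K : nat -> set G) :
  measurable E -> (forall n, measurable (K n : set (borel G))) -> nondecreasing_seq K ->
  \bigcup_n K n = setT -> (forall n, rtrans (K n) (x n) `<=` E) ->
  exists2 mu : {scalar Linf}, TLIM haar mu & mu (chi haar E) = 1.
Proof.
move=> mE mK ndK KT KE; have [B [cB B0]] := haar_compact_gt0 hG H.
have lB := l1_unif cB.
have [mu muE] := scalar_pack (shift_mean_scalar lB).
have muEE phi : mu phi = shift_mean phi (uniform_density B) by rewrite muE.
have eE : ess_bounded \1_E 1.
  split => //; apply: aeW => z; rewrite indicE.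
  by case: (z \in E); rewrite ?normr1 ?normr0.
exists mu; last first.
  rewrite muEE (_ : chi haar E = \1_E :> (borel G -> R)); last exact: (toLE haar0 eE).
  apply: (shift_mean_eq1 lB eE) => y.
  exact: (conv_unif_indic_cvg _ cB B0 mE mK ndK KT KE).
split.
  apply: (mean_of_positive haar0).
    by move=> phi p0; rewrite muEE; apply: shift_mean_ge0 => // z; exact: unif_ge0.
  rewrite muEE (toLE haar0 (essb_cst haar 1)).
  apply: (shift_mean_eq1 lB (essb_cst haar 1)) => y.
  rewrite (_ : (fun n => _) = cst 1); first exact: cvg_cst.
  by apply/funext => n; rewrite conv_cst1 Rintegral_unif.
move=> f phi [f1 f0]; have [C pC] := Linfty_essb haar0 phi.
have lf : l1 f by apply/Lfun1_integrable; exact: LfunP.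
have eb := luc_essb (conv_bounded lf pC) (conv_luc hG sG H lf pC).
have cE : convol f phi = conv f phi :> (borel G -> R) by exact: (toLE haar0 eb).
rewrite !muEE cE (shift_mean_absorb lf pC cB B0).
have [c lamc] := shift_mean_const pC.
rewrite !lamc// Rintegral_unif//; congr (_ * _).
have -> : \int[haar]_y f y = nrm1 f.
  rewrite /Rintegral; congr fine; apply: ae_eq_integral => //.
  - by have /integrableP[] := lf.
  - by have /integrableP[] := l1_norm lf.
  - have [N [mN N0 NP]] := f0.
    exists N; split => // z nz; apply: NP => /= pz; apply: nz => _.
    by rewrite ger0_norm.
by rewrite /nrm1 /Rintegral; move: f1; rewrite Lnorm1 => ->.
Qed.

End ThickMean.

(** * Thick sets on which the modular function is sparse *)

Section Sequence.
Context {R : realType} {G : topGroupType}.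
Hypotheses (hG : hausdorff_space G) (sG : sigma_compact [set: G]).
Variable haar : {measure set (borel G) -> \bar R}.
Hypothesis H : left_haar haar.

Let mcpt (K : set G) (cK : compact K) : measurable (K : set (borel G)) :=
  borel_compact hG cK.

Variable D : G -> R.
Hypotheses (D0 : forall z, 0 < D z) (DM : forall x y, D (x * y)%g = D x * D y)
  (DE : forall z (E : set (borel G)), measurable E ->
    haar (rtrans E z) = ((D z)%:E * haar E)%E).

Lemma modular1 : D 1%g = 1.
Proof.
have := DM 1%g 1%g; rewrite mulg1 -{1}[D 1%g]mulr1 => /mulfI -> //.
by rewrite gt_eqF.
Qed.

Lemma modularV z : D (z^-1)%g = (D z)^-1.
Proof.
have Dz : D z != 0 by rewrite gt_eqF.
by apply: (mulfI Dz); rewrite -DM mulgV modular1 mulfV.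
Qed.

(** Non-unimodularity gives a [z] with [D z] different from 1; then [z] or its
    inverse has powers of arbitrarily small modulus. *)
Lemma modular_small : ~ unimodular haar -> forall e : R, 0 < e -> exists x, D x < e.
Proof.
move=> nu e e0.
have [z z1] : exists z, D z < 1.
  apply: contrapT => /forallNP nz; apply: nu => x E mE.
  rewrite DE// (_ : D x = 1) ?mul1e//; apply/eqP; rewrite eq_le.
  apply/andP; split; last by rewrite leNgt; apply/negP; exact: nz.
  have := nz (x^-1)%g; rewrite modularV => /negP; rewrite -leNgt.
  by rewrite invf_ge1.
have DX n : exists x, D x = D z ^+ n.
  elim: n => [|n [x Dx]]; first by exists 1%g; rewrite modular1.
  by exists (z * x)%g; rewrite DM Dx exprS.
have : D z ^+ n @[n --> \oo] --> (0 : R).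
  by apply: cvg_expr; rewrite ger0_norm// ltW.
move=> /cvgrPdist_lt /(_ _ e0)[n _ Hn].
have [x Dx] := DX n; exists x; rewrite Dx.
by have := Hn n (leqnn n); rewrite sub0r normrN; apply: le_lt_trans; exact: ler_norm.
Qed.

(** All the [rtrans B k] with [k] in [K] are contained in the compact set
    [mulset B K]. *)
Lemma modular_bounded (K : set G) : compact K ->
  exists M : R, 0 < M /\ forall k, K k -> D k <= M.
Proof.
move=> cK; have [B [cB B0]] := haar_compact_gt0 hG H.
have Bf := haar_fin_num H cB.
have fB0 : 0 < fine (haar B) by rewrite fine_gt0// B0/= -ge0_fin_numE.
have cBK := compact_mulset cB cK; have BKf := haar_fin_num H cBK.
exists ((fine (haar (mulset B K)) + 1) / fine (haar B)); split.
  by rewrite divr_gt0// ltr_wpDl// fine_ge0.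
move=> k Kk; rewrite ler_pdivlMr//.
apply: (@le_trans _ _ (fine (haar (mulset B K)))); last by rewrite lerDl.
rewrite -lee_fin EFinM !fineK// -DE; last exact: mcpt.
apply: le_measure; rewrite ?inE.
- by apply: measurable_rtrans; exact: mcpt.
- exact: mcpt.
- by move=> _ [b Bb <-]; exists (b, k).
Qed.

(** If [D x] is small then so are |K x| and the values of [D] on [K x], which
    are at least [D x / N] when [N] bounds [D] on the inverses of [K]. *)
Lemma sparse_step (K : set G) (m : R) : ~ unimodular haar -> compact K -> 0 < m ->
  exists q : G * R, [/\ 0 < q.2, q.2 <= m / 2, (haar (rtrans K q.1) <= (m / 2)%:E)%E &
    forall y, rtrans K q.1 y -> q.2 <= D y < m].
Proof.
move=> nu cK m0; have [M [M0 KM]] := modular_bounded cK.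
have [N [N0 KN]] := modular_bounded (compact_invset cK).
have Kf := haar_fin_num H cK; have mK := mcpt cK.
have k1 : 0 < fine (haar K) + 1 by rewrite ltr_wpDl// fine_ge0.
have e0 : 0 < Num.min (m / M) (m / 2 / (fine (haar K) + 1)).
  by rewrite lt_min !divr_gt0.
have [x] := modular_small nu e0; rewrite lt_min => /andP[xM xK].
(* the new lower bound for [D]: halved at each step, and valid on [K x] *)
exists (x, Num.min (m / 2) (D x / N)) => /=; split.
- by rewrite lt_min !divr_gt0.
- by rewrite ge_min lexx.
- rewrite DE// -(fineK Kf) -EFinM lee_fin.
  move: xK; rewrite ltr_pdivlMr// => /ltW; apply: le_trans.
  by rewrite ler_wpM2l ?(ltW (D0 x))// lerDl.
- move=> _ [k Kk <-]; rewrite DM; apply/andP; split.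
    rewrite ge_min; apply/orP; right; rewrite ler_pdivrMr// -mulrA mulrC.
    rewrite -mulrA ler_peMr ?(ltW (D0 x))//.
    have : D (k^-1)%g <= N by apply: KN; rewrite /invset/= invgK.
    rewrite modularV => kN; rewrite mulrC -ler_pdivrMl ?mulr1//.
  apply: le_lt_trans (_ : M * D x < _); first by rewrite ler_wpM2r ?KM// ltW.
  by move: xM; rewrite ltr_pdivlMr// mulrC.
Qed.

Lemma sparse_sequence (K : nat -> set G) : ~ unimodular haar ->
  (forall n, compact (K n)) ->
  exists (x : nat -> G) (d : nat -> R), [/\ d 0%N = 1, forall n, 0 < d n,
    forall n, d n.+1 <= d n / 2, forall n,
      (haar (rtrans (K n) (x n)) <= (d n / 2)%:E)%E &
    forall n y, rtrans (K n) (x n) y -> d n.+1 <= D y < d n].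
Proof.
move=> nu cK.
(* The pair is the rank [n] and the current bound; positivity is a premise
   within the conclusion for the sake of [choice]. *)
have h (p : nat * R) : exists q : G * R, 0 < p.2 ->
    [/\ 0 < q.2, q.2 <= p.2 / 2, (haar (rtrans (K p.1) q.1) <= (p.2 / 2)%:E)%E &
     forall y, rtrans (K p.1) q.1 y -> q.2 <= D y < p.2].
  have [p0|p0] := pselect (0 < p.2); last by exists (1%g, 0).
  by have [q Hq] := sparse_step nu (cK p.1) p0; exists q.
have [f Hf] := choice h.
pose fix d n := if n is n'.+1 then (f (n', d n')).2 else 1 : R.
have d0 n : 0 < d n.
  by elim: n => [//|n IH] /=; have [] := Hf (n, d n) IH.
exists (fun n => (f (n, d n)).1), d; split => //.
- by move=> n; have [] := Hf (n, d n) (d0 n).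
- by move=> n; have [] := Hf (n, d n) (d0 n).
- by move=> n; have [] := Hf (n, d n) (d0 n).
Qed.

End Sequence.

(** * A bound for almost invariant compact sets *)

Section Counting.
Context {R : realType} {G : topGroupType}.
Hypotheses (hG : hausdorff_space G) (sG : sigma_compact [set: G]).
Variable haar : {measure set (borel G) -> \bar R}.
Hypothesis H : left_haar haar.

Let mcpt (K : set G) (cK : compact K) : measurable (K : set (borel G)) :=
  borel_compact hG cK.

Variable D : G -> R.
Hypotheses (D0 : forall z, 0 < D z) (DM : forall x y, D (x * y)%g = D x * D y)
  (DE : forall z (E : set (borel G)), measurable E ->
    haar (rtrans E z) = ((D z)%:E * haar E)%E).

(** Count the pairs [(x, s)] with [x] in [K] and [s], [x s] in [A]. Each [x]
    contributes at least 7/8 |A| by almost invariance. An [s] contributes at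
    most |A s^-1| = |A| / D s <= 8 when it is in [E] and not in [T], and at most
    |K| otherwise, where [T] and [A `\` E] have measure at most |A| / 8 and
    5/8 |A|. *)
Lemma folner_bound (A K : set G) (E T : set (borel G)) (c : R) : c = 8^-1 ->
  compact A -> compact K -> (0 < haar A)%E -> measurable E -> measurable T ->
  (forall s : G, A s -> E s -> ~ T s -> c * fine (haar A) <= D s) ->
  (haar T <= (c * fine (haar A))%:E)%E ->
  (haar ((A : set (borel G)) `\` E) <= (5 * c * fine (haar A))%:E)%E ->
  (forall x, K x -> fine (haar (ltrans x A `+` A)) / fine (haar A) < c) ->
  c * fine (haar K) <= 8.
Proof.
move=> cE cA cK A0 mE mT hD hT hAE hK.
have Af := haar_fin_num H cA; have Kf := haar_fin_num H cK.
have mA := mcpt cA; have mK := mcpt cK.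
pose a := fine (haar A); pose k := fine (haar K).
have a0 : 0 < a by rewrite fine_gt0// A0/= -ge0_fin_numE.
have k0 : 0 <= k by exact: fine_ge0.
have c0 : 0 < c by rewrite cE invr_gt0.
have clA := compact_closed hG cA.
pose C := (K `*` A) `&` [set p : G * G | A (p.1 * p.2)%g].
have cC : compact C.
  apply: compact_closedI; first exact: compact_setX.
  by apply: closed_comp => // p _; exact: mulg_continuous.
have F := compact_fubini hG hG (haar_on_fin hG H cK) (haar_on_fin hG H cA)
  (tight_haar_on hG H cK) (tight_haar_on hG H cA) cC.
have mCs (s : G) : measurable ([set x | C (x, s)] : set (borel G)).
  by apply: mcpt; exact: (@compact_xsect G G hG _ s (compact_swap cC)).
have lower : ((7 * c * a * k)%:E <= \int[haar_on hG haar cK]_x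
  (haar_on hG haar cA [set s | C (x, s)]))%E.
  have <- : (\int[haar_on hG haar cK]_(x in K) (cst (7 * c * a)%:E) x =
    (7 * c * a * k)%:E)%E.
    by rewrite integral_cst// haar_onE setIid [RHS]EFinM /k fineK.
  rewrite integral_mkcond; apply: ge0_le_integral => //.
  - move=> x _; rewrite patchE; case: ifP => // _; rewrite /cst lee_fin.
    by rewrite !mulr_ge0 ?(ltW c0)// (ltW a0).
  - apply/(measurable_restrictT _ mK); exact: measurable_cst.
  - exact: (measurable_xsect_meas hG hG (haar_on_fin hG H cA) (tight_haar_on hG H cA)
    cC).
  move=> x _; have [xK|nxK] := pselect (K x); last first.
    by rewrite patchE memNset//; exact: measure_ge0.
  rewrite patchE mem_set//.
  rewrite haar_onE /cst.
  pose S : set G := A `&` [set s | A (x * s)%g].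
  have cS : compact S.
    by apply: compact_closedI => //; apply: closed_comp => // s _;
      exact: mulgl_continuous.
  have -> : [set s | C (x, s)] `&` A = S.
    apply/seteqP; split => [s [[_ As]] //|s [As Axs]]; split => //.
  rewrite -(haar_ltrans H x (mcpt cS)).
  have SE : ltrans x S = ltrans x A `&` A.
    by rewrite !ltransE; apply/funext => y; rewrite /S/= /setI/= mulVKg.
  have cxA : compact (ltrans x A) by exact: compact_ltrans.
  have mxA := mcpt cxA.
  have mD1 : measurable ((ltrans x A `\` A) : set (borel G)) by exact: measurableD.
  have mD2 : measurable ((A `\` ltrans x A) : set (borel G)) by exact: measurableD.
  have mY : measurable ((ltrans x A `+` A) : set (borel G)) by exact: measurableU.
  have Yf : haar (ltrans x A `+` A) \is a fin_num.
    rewrite ge0_fin_numE//; apply: le_lt_trans (_ : (haar (ltrans x A `|` A) < +oo)%E).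
      apply: le_measure; rewrite ?inE//; first exact: measurableU.
      by move=> y [[]|[]]; [left|right].
    by apply: (haar_compact H); exact: compactU.
  have Yc : (haar (ltrans x A `+` A) <= (c * a)%:E)%E.
    rewrite -(fineK Yf) lee_fin ltW// -ltr_pdivrMr//; exact: hK.
  have : (haar A <= haar (ltrans x S) + haar (ltrans x A `+` A))%E.
    have mxS : measurable (ltrans x S : set (borel G)).
      by apply: measurable_ltrans; exact: mcpt.
    apply: le_trans (measureU2 haar mxS mY).
    apply: le_measure; rewrite ?inE//; first exact: measurableU.
    move=> y Ay; have [xAy|nxAy] := pselect (ltrans x A y).
      by left; rewrite SE.
    by right; right.
  move=> h; have {}h := le_trans h (leeD (lexx _) Yc).
  have -> : (7 * c * a)%:E = (haar A - (c * a)%:E)%E.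
    rewrite -(fineK Af) -EFinB; congr EFin; rewrite -/a.
    have e8 : a = 8 * c * a by rewrite cE mulfV// mul1r.
    apply/eqP; rewrite eq_sym subr_eq {1}e8 -!mulrA.
    by rewrite -[X in _ == _ + X]mul1r -mulrDl natr1.
  by rewrite leeBlDr.
have upper : (\int[haar_on hG haar cA]_s (haar_on hG haar cK [set x | C (x, s)]) <=
    (8 * a)%:E + (k * (c * a))%:E + (k * (5 * c * a))%:E)%E.
  have mAE : measurable ((A : set (borel G)) `\` E) by exact: measurableD.
  (* a measurable bound for the contribution of [s] *)
  pose g (s : borel G) : \bar R :=
    (8%:E + k%:E * (\1_T s)%:E + k%:E * (\1_((A : set (borel G)) `\` E) s)%:E)%E.
  have mg1 : measurable_fun setT (fun s : borel G => k%:E * (\1_T s)%:E)%E.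
    by apply: measurable_funeM; apply/measurable_EFinP; exact: measurable_indic.
  have mg2 : measurable_fun setT
    (fun s : borel G => k%:E * (\1_((A : set (borel G)) `\` E) s)%:E)%E.
    by apply: measurable_funeM; apply/measurable_EFinP; exact: measurable_indic.
  have p1 s : (0 <= k%:E * (\1_T s)%:E :> \bar R)%E by rewrite mule_ge0 ?lee_fin.
  have p2 s : (0 <= k%:E * (\1_((A : set (borel G)) `\` E) s)%:E :> \bar R)%E by
    rewrite mule_ge0 ?lee_fin.
  have mg0 : measurable_fun setT (fun s : borel G => 8%:E + k%:E * (\1_T s)%:E)%E.
    by apply: emeasurable_funD.
  apply: (@le_trans _ _ (\int[haar_on hG haar cA]_s g s)%E).
    apply: ge0_le_integral => //.
    - exact: (measurable_xsect_meas hG hG (haar_on_fin hG H cK) (tight_haar_on hG H cK)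
      (compact_swap cC)).
    - exact: emeasurable_funD.
    move=> s _; have [As|nAs] := pselect (A s); last first.
      have -> : [set x | C (x, s)] = set0.
        by apply/seteqP; split => // x [[_ /= /nAs]].
      by rewrite measure0 /g !adde_ge0// lee_fin.
    rewrite haar_onE /g.
    have gk : (haar ([set x | C (x, s)] `&` K) <= k%:E)%E.
      rewrite fineK//; apply: measureIr => //.
    have [Ts|nTs] := pselect (T s).
      apply: (le_trans gk); rewrite indicE mem_set// mule1.
      by rewrite (addeC 8%:E) -addeA leeDl// adde_ge0// lee_fin.
    have [Es|nEs] := pselect (E s); last first.
      apply: (le_trans gk); rewrite [\1_(_ `\` _) s]indicE mem_set// mule1.
      by rewrite leeDr// adde_ge0// lee_fin.
    apply: (@le_trans _ _ 8%:E); last by rewrite -addeA leeDl// adde_ge0.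
    apply: (@le_trans _ _ (haar (rtrans A (s^-1)%g))).
      apply: le_measure; rewrite ?inE.
      - by apply: measurableI => //; exact: mCs.
      - exact: measurable_rtrans.
      - by rewrite rtransE => x [[_ /=]]; rewrite invgK.
    rewrite DE// (modularV D0 DM) -(fineK Af) -EFinM lee_fin.
    rewrite -ler_pdivlMl ?invr_gt0// invrK mulrC -ler_pdivrMl//.
    have := hD s As Es nTs; rewrite cE.
    by [].
  rewrite /g ge0_integralD//; last by move=> s _; rewrite adde_ge0// lee_fin.
  have mi (X : set (borel G)) : measurable X ->
      (\int[haar_on hG haar cA]_s (k%:E * (\1_X s)%:E) = k%:E * haar (X `&` A))%E.
    move=> mX; rewrite ge0_integralZl//; last by apply/measurable_EFinP;
      exact: measurable_indic.
    by rewrite integral_indic// setIT.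
  have i8 : (\int[haar_on hG haar cA]_s 8%:E = (8 * a)%:E)%E.
    by rewrite (integral_cst _ _ 8%:E)// haar_onE setTI [RHS]EFinM /a fineK.
  rewrite ge0_integralD// i8 !mi//.
  apply: leeD; first apply: leeD => //.
    rewrite (EFinM k) lee_wpmul2l ?lee_fin//; apply: le_trans hT.
    exact: measureIl.
  rewrite (EFinM k) lee_wpmul2l ?lee_fin//; apply: le_trans hAE.
  exact: measureIl.
have := le_trans lower (le_trans _ upper); rewrite F => /(_ (lexx _)).
rewrite -!EFinD lee_fin => hfin.
have {hfin} : 7 * (c * k) * a <= (8 + 6 * (c * k)) * a.
  have -> : 7 * (c * k) * a = 7 * c * a * k by rewrite mulrA mulrAC.
  apply: le_trans hfin _.
  have -> : (8 + 6 * (c * k)) * a = 8 * a + k * (c * a) + k * (5 * c * a).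
    rewrite mulrDl -addrA; congr (_ + _).
    have -> : (6 : R) = 1 + 5 by rewrite nat1r.
    rewrite (mulrDl 1 5) mul1r [LHS]mulrDl; congr (_ + _);
      first by rewrite mulrAC mulrC.
    by rewrite mulrA mulrAC mulrC.
  by [].
rewrite ler_pM2r//.
have -> : 7 * (c * k) = c * k + 6 * (c * k).
  have -> : (7 : R) = 1 + 6 by rewrite nat1r.
  by rewrite mulrDl mul1r.
by rewrite lerD2r.
Qed.

End Counting.

(** * The half sum of two means *)

Section Final.
Context {R : realType} {G : topGroupType}.
Hypotheses (hG : hausdorff_space G) (sG : sigma_compact [set: G]).
Variable haar : {measure set (borel G) -> \bar R}.
Hypothesis H : left_haar haar.
Local Notation Linf := (@Linfty R G haar).

Let mcpt (K : set G) (cK : compact K) : measurable (K : set (borel G)) :=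
  borel_compact hG cK.

Let haar0 : (0 < haar setT)%E.
Proof. by rewrite measure_gt0; exact: (haar_neq0 H). Qed.

Lemma chiE (E : set (borel G)) : measurable E -> chi haar E = \1_E :> (borel G -> R).
Proof.
move=> mE; apply: (@toLE _ _ _ haar0 _ 1); split => //; apply: aeW => z.
by rewrite indicE; case: (z \in E); rewrite ?normr1 ?normr0.
Qed.

Lemma pairing_mean_of (A : set G) (E : set (borel G)) : compact A -> measurable E ->
  dual_of_L1 (mean_of haar A) (chi haar E) =
  fine (haar ((A : set (borel G)) `&` E)) / fine (haar A).
Proof.
move=> cA mE; have mA := mcpt cA.
have lA : l1 haar (\1_(A : set (borel G))) by apply: l1_indic => //;
  exact: (haar_compact H).
have lA' : l1 haar (fun x => \1_(A : set (borel G)) x / fine (haar A)).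
  have := l1Z (fine (haar A))^-1 lA.
  by under eq_fun do rewrite mulrC.
have mAE : mean_of haar A = (fun x => \1_(A : set (borel G)) x / fine (haar A)) :>
  (borel G -> R).
  by rewrite /mean_of insubdK//; apply/Lfun1_integrable.
have mAI : measurable ((A : set (borel G)) `&` E) by exact: measurableI.
rewrite /dual_of_L1 /= /pairing mAE chiE//.
rewrite -(Rintegral_indicT haar mAI) mulrC -RintegralZl//; last first.
  apply: l1_indic => //; apply: le_lt_trans (haar_compact H cA).
  exact: measureIl.
apply: eq_Rintegral => x _; rewrite !indicE in_setI mulrAC mulrC.
by case: (x \in A); rewrite ?mul0r ?mul1r.
Qed.

Lemma TLIM_half (mu0 mu1 : {scalar Linf}) : TLIM haar mu0 -> TLIM haar mu1 ->
  exists2 mu : {scalar Linf}, TLIM haar mu & forall phi, mu phi = (mu0 phi + mu1 phi) /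
    2.
Proof.
move=> [m0 t0] [m1 t1].
have sc : scalar (fun phi : Linf => (mu0 phi + mu1 phi) / 2).
  move=> a phi psi; rewrite !linearD !linearZ /= addrACA -mulrDr mulrDl -mulrA.
  by [].
have [mu muE] := scalar_pack sc.
have muEE phi : mu phi = (mu0 phi + mu1 phi) / 2 by rewrite muE.
exists mu => //; split.
  apply: (mean_of_positive haar0).
    move=> phi p0; rewrite muEE divr_ge0// addr_ge0//.
      by have [_ h] := m0; exact: h.
    by have [_ h] := m1; exact: h.
  by rewrite muEE (mean1 haar0 m0) (mean1 haar0 m1) -mulr2n mulfV.
by move=> f phi mf; rewrite !muEE (t0 f)// (t1 f).
Qed.

(** The measures are dominated by the differences [d n - d n.+1], whose sum
    telescopes. *)
Lemma tail_le (Q : nat -> set (borel G)) (d : nat -> R) :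
  (forall n, measurable (Q n)) ->
  (forall n, 0 < d n) -> (forall n, d n.+1 <= d n / 2) ->
  (forall n, (haar (Q n) <= (d n / 2)%:E)%E) ->
  forall N, (haar (\bigcup_k Q (N + k)%N) <= (d N)%:E)%E.
Proof.
move=> mQ d0 dS Qd N.
pose U k := \big[setU/set0]_(i < k) Q (N + i)%N.
have mU k : measurable (U k) by exact: bigsetU_measurable.
have UT : \bigcup_k U k = \bigcup_k Q (N + k)%N.
  apply/seteqP; split => [z [k _]|z [k _ Qz]].
    by rewrite /U -(bigcup_mkord k (fun i => Q (N + i)%N)) => -[i _ Qz]; exists i.
  by exists k.+1 => //; rewrite /U big_ord_recr/=; right.
have Ud k : (haar (U k) <= (d N - d (N + k)%N)%:E)%E.
  elim: k => [|k IH]; first by rewrite /U big_ord0 measure0 addn0 subrr.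
  have -> : U k.+1 = U k `|` Q (N + k)%N by rewrite /U big_ord_recr.
  apply: le_trans (measureU2 haar (mU k) (mQ _)) _.
  apply: le_trans (leeD IH (Qd _)) _; rewrite -EFinD lee_fin addnS.
  rewrite -addrA lerD2l {1}(splitr (d (N + k)%N)) opprD -addrA addNr addr0 lerN2.
  exact: dS.
have cv : haar (U k) @[k --> \oo] --> haar (\bigcup_k Q (N + k)%N).
  rewrite -UT; apply: nondecreasing_cvg_mu => //.
    by apply: bigcup_measurable.
  by move=> i j ij; apply/subsetPset; exact: (@subset_bigsetU _ (fun i => Q (N + i)%N)).
rewrite -(cvg_lim _ cv)//; apply: lime_le; first exact: cvgP cv.
apply: nearW => k; apply: le_trans (Ud k) _.
by rewrite lee_fin gerBl ltW.
Qed.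

End Final.

Theorem theorem6p2 (R : realType) (G : topGroupType)
    (haar : {measure set (borel G) -> \bar R}) :
  hausdorff_space G -> locally_compact [set: G] -> sigma_compact [set: G] ->
  left_haar haar -> amenable haar -> ~ unimodular haar ->
  TLIM0 haar <> TLIM haar.
Proof.
move=> hG _ sG H [m mm mi] nu TLIM_eq.
have haar0 : (0 < haar setT)%E by rewrite measure_gt0; exact: (haar_neq0 H).
have [D [D0 DM DE]] := modular_function hG sG H.
have [K [cK ndK KT]] := compact_exhaustion sG.
have [x [d [d1 d0 dS hQ DQ]]] := sparse_sequence hG H D0 DM DE nu cK.
have [w [uw woo]] := @ultraFilterLemma nat \oo _.
(* the bands on which [D] lies between [d n.+1] and [d n] *)
pose Q n : set (borel G) := rtrans (K n) (x n).
have mQ n : measurable (Q n) by apply: measurable_rtrans;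
  exact: (borel_compact hG (cK n)).
pose E (b : bool) : set (borel G) := \bigcup_n Q (n.*2 + b)%N.
have mE b : measurable (E b) by exact: bigcup_measurable.
have thick (b : bool) : exists2 mu :
  {scalar Linfty haar}, TLIM haar mu & mu (chi haar (E b)) = 1.
  apply: (thick_TLIM hG sG H (x := fun n => x (n.*2 + b)%N) uw woo mm mi
    (K := fun n => K (n.*2 + b)%N)).
  - exact: mE.
  - by move=> n; exact: (borel_compact hG (cK _)).
  - by move=> i j ij; apply: ndK; rewrite leq_add2r leq_double.
  - apply/seteqP; split => // z _; have : [set: G] z by [].
    rewrite -KT => -[n _ Kz]; exists n => //.
    have nb : (n <= n.*2 + b)%N by rewrite -addnn -addnA leq_addr.
    by have /subsetPset := ndK _ _ nb; exact.
  - by move=> n z Qz; exists n.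
have [mu0 T0 mu0E] := thick false; have [mu1 T1 mu1E] := thick true.
have [mu Tmu muE] := TLIM_half H T0 T1.
have [_ pos0] := T0.1; have [_ pos1] := T1.1.
have chi_ge0 b : \forall z \ae haar, 0 <= chi haar (E b) z.
  by apply: aeW => z; rewrite chiE.
have mu_ge b : 1 / 2 <= mu (chi haar (E b)).
  rewrite muE ler_pM2r ?invr_gt0//; case: b.
    by rewrite mu1E lerDr; exact: pos0.
  by rewrite mu0E lerDl; exact: pos1.
have d_anti i j : (i <= j)%N -> d j <= d i.
  move=> /subnKC <-; elim: (j - i)%N => [|k IH]; first by rewrite addn0.
  rewrite addnS; apply: le_trans (dS _) (le_trans _ IH).
  by rewrite ler_pdivrMr// ler_peMr ?ler1n// ltW.
have Qinj i j z : Q i z -> Q j z -> i = j.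
  wlog ij : i j / (i < j)%N.
    move=> h Qi Qj; have [ij|ji|//] := ltngtP i j; first exact: h ij Qi Qj.
    by apply/esym; exact: h ji Qj Qi.
  move=> /DQ /andP[h1 _] /DQ /andP[_ h2].
  by have := lt_le_trans h2 (le_trans (d_anti _ _ ij) h1); rewrite ltxx.
have disjE : E false `&` E true = set0.
  apply/seteqP; split => // z [[i _ Qi] [j _ Qj]].
  have /(congr1 odd) := Qinj _ _ _ Qi Qj.
  by rewrite !oddD !odd_double.
have [B [cB B0]] := haar_compact_gt0 hG H.
have Bf := haar_fin_num H cB.
have fB0 : 0 < fine (haar B) by rewrite fine_gt0// B0/= -ge0_fin_numE.
(* translating by the inverse of an element of small modulus gives a compact
   set of large measure *)
have [y Dy] := modular_small D0 DM DE nu (divr_gt0 fB0 (ltr0Sn R 64)).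
pose K0 := rtrans B (y^-1)%g.
have cK0 : compact K0 by exact: compact_rtrans.
have K0_big : 65 < fine (haar K0).
  rewrite /K0 DE ?(modularV D0 DM)//; last exact: (borel_compact hG cB).
  rewrite -(fineK Bf) -EFinM/= mulrC ltr_pdivlMr// mulrC -ltr_pdivlMr//.
(* a precision below the mass 1/2 that each of the two sets has: at least
   3/8 of [A] is then in each of them *)
pose c : R := 8^-1.
have c0 : 0 < c by rewrite invr_gt0.
have c01 : 0 < c < 1 by rewrite c0/= invf_lt1// ltr1n.
have muT0 : TLIM0 haar mu by rewrite TLIM_eq.
have [_ /(_ _ K0 c _ cK0 c01) near_mu] := muT0.
(* the cells of a partition are nonempty, hence the condition on the third one *)
pose P : set (set (borel G)) := [set E false; E true] `|`
  [set X | X = ~` (E false `|` E true) /\ X !=set0].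
have E_neq0 b : E b !=set0.
  apply/set0P/negP => /eqP E0; have := mu_ge b.
  have -> : chi haar (E b) = 0.
    by apply: Linf_eq => z; rewrite chiE// E0 indicE in_set0.
  by rewrite linear0 leNgt divr_gt0.
have pP : finite_measurable_partition P.
  split.
  - rewrite finite_setU; split; first exact: finite_set2.
    by apply: (@sub_finite_set _ _ [set ~` (E false `|` E true)]) => // X [].
  - move=> X [[->|->]|[-> _]]; [exact: mE|exact: mE|].
    by apply: measurableC; apply: measurableU; exact: mE.
  - split.
    + apply/seteqP; split => // z _.
      have [z0|nz0] := pselect (E false z); first by exists (E false) => //; left; left.
      have [z1|nz1] := pselect (E true z); first by exists (E true) => //; left; right.
      exists (~` (E false `|` E true)); last by case.
      by right; split => //; exists z; case.
    + move=> X Y PX PY [z [Xz Yz]].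
      have no01 : E false z -> E true z -> False.
        by move=> h0 h1; have : (E false `&` E true) z by []; rewrite disjE.
      case: PX PY Xz Yz => [[->|->]|[-> _]] [[->|->]|[-> _]] Xz Yz //=; exfalso.
      * exact: no01.
      * by apply: Yz; left.
      * exact: no01.
      * by apply: Yz; right.
      * by apply: Xz; left.
      * by apply: Xz; right.
    + by move=> X [[->|->]|[-> ?]].
have [A [cA A0 AK] [_ Amu]] := near_mu _ pP.
have Af := haar_fin_num H cA; have mA := borel_compact hG cA.
pose a := fine (haar A).
have a0 : 0 < a by rewrite fine_gt0// A0/= -ge0_fin_numE.
have ca0 : 0 < c * a by rewrite mulr_gt0.
have small_d : exists n, d n.+1 <= c * a.
  have d_le n : d n <= 2^-1 ^+ n.
    elim: n => [|n IH]; first by rewrite d1.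
    by apply: le_trans (dS n) _; rewrite exprSr ler_wpM2r.
  have : (2^-1 : R) ^+ n @[n --> \oo] --> (0 : R).
    by apply: cvg_expr; rewrite ger0_norm// invf_lt1// ltr1n.
  move=> /cvgrPdist_lt /(_ _ ca0)[n _ Hn].
  exists n; apply: le_trans (d_le _) _.
  have := Hn n.+1 (leqnSn n); rewrite sub0r normrN => /ltW.
  by apply: le_trans; exact: ler_norm.
case: (ex_minnP small_d) => n dn nmin.
(* The band [Q n] may contain points on both sides of the threshold [c * a];
   it is avoided by taking the union of the other parity. *)
pose b := ~~ odd n.
(* the later bands, which contain all the points of [E b] below the threshold *)
pose T : set (borel G) := \bigcup_k Q (n.+1 + k)%N.
have mT : measurable T by apply: bigcup_measurable.
have hT : (haar T <= (c * a)%:E)%E.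
  by apply: le_trans (tail_le mQ d0 dS hQ n.+1) _; rewrite lee_fin.
have hD s : A s -> E b s -> ~ T s -> c * a <= D s.
  move=> _ [i _ Qs] nTs; set j := (i.*2 + b)%N in Qs.
  have jn : j != n.
    apply/negP => /eqP /(congr1 odd); rewrite /j oddD odd_double /b.
    by case: (odd n).
  have [jn'|nj] := ltnP j n; last first.
    exfalso; apply: nTs; exists (j - n.+1)%N => //.
    by rewrite subnKC// ltn_neqAle eq_sym jn.
  have /andP[djs _] := DQ _ _ Qs; apply: le_trans djs; rewrite leNgt; apply/negP => dj.
  by have := nmin j (ltW dj); rewrite leqNgt jn'.
have mAE : measurable ((A : set (borel G)) `&` E b) by exact: measurableI.
have AEf : haar ((A : set (borel G)) `&` E b) \is a fin_num.
  rewrite ge0_fin_numE//; apply: le_lt_trans (haar_compact H cA).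
  exact: measureIl.
have PEb : P (E b) by left; case: (b); [right|left].
have hAE : (haar ((A : set (borel G)) `\` E b) <= (5 * c * a)%:E)%E.
  have -> : haar ((A : set (borel G)) `\` E b) =
      (a - fine (haar ((A : set (borel G)) `&` E b)))%:E.
    rewrite measureD//; last exact: (haar_compact H cA).
    rewrite EFinB; congr (_ - _)%E; first exact: esym (fineK Af).
    exact: esym (fineK AEf).
  rewrite lee_fin.
  have := Amu _ PEb; rewrite pairing_mean_of//.
  set v := fine _; rewrite -/a => hv.
  have {hv} : 3 * c < v / a.
    have := le_lt_trans (ler_norm _) hv; rewrite ltrBlDr -ltrBlDl => hv'.
    apply: le_lt_trans hv'; apply: le_trans (lerB (mu_ge b) (lexx c)).
    have -> : 1 / 2 = 4 * c.
      have e8 : (8 : R) = 4 * 2 by rewrite -natrM.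
      by rewrite /c e8 invfM mulrA mulfV.
    by rewrite lerBrDr -{2}[c]mul1r -mulrDl natr1.
  rewrite ltr_pdivlMr// => hv; rewrite lerBlDr.
  have e : 5 * c * a + 3 * c * a = a.
    by rewrite -mulrDl -mulrDl -natrD /c mulfV// mul1r.
  by rewrite -[leLHS]e lerD2l ltW.
have := folner_bound hG H D0 DM DE erefl cA cK0 A0 (mE b) mT hD hT hAE AK.
rewrite /c mulrC ler_pdivrMr// leNgt => /negP; apply.
apply: le_lt_trans K0_big.
by rewrite -natrM ler_nat.
Qed.
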